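(* Let $\Omega\subset\mathbb{R}$ be a bounded open interval, $b\in\mathbb{R}\setminus\{0\}$ constant, $f\in L_2(\Omega)$, $\mathcal{T}_h$ a mesh of $\Omega$ with shape-regularity constant $\kappa_{\mathcal{T}_h}$, and $k'\ge 0$ an integer. Let $u_h\in L_2(\Omega)$ satisfy $$(f,\psi_a)_{\omega_a}+(u_h,b\nabla\psi_a)_{\omega_a}=0\qquad\forall\,a\in\mathcal{V}_h^{\mathrm{int}}\cup\mathcal{V}_h^{\partial_-\Omega}.$$ Then, for every vertex $a\in\mathcal{V}_h$, there exists a unique $s_h^a\in X_h^a=\mathcal{P}^{k'}(\mathcal{T}_a)\cap H^1(\omega_a)$ such that $$(b\nabla(\psi_a s_h^a),v_h)_{\omega_a}=(f\psi_a+(b\nabla\psi_a)u_h,\,v_h)_{\omega_a}\qquad\forall\,v_h\in Y_h^a=\mathcal{P}^{k'}(\mathcal{T}_a).$$ Moreover it is stable in the sense that $$\|s_h^a\|_{\omega_a}\le C\bigl(h_{\omega_a}\|f\|_{\omega_a}+\|u_h\|_{\omega_a}\bigr)$$ for some constant $C>0$ only depending on the shape-regularity constant $\kappa_{\mathcal{T}_h}$, the polynomial degree $k'$, and the advection parameter $b$.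
   Context: Notation: $(v,w)_D=\int_D vw$, $\|v\|_D=(v,v)_D^{1/2}$; $\nabla v=v'$. With $n=\pm1$ the outward unit normal at the endpoints of $\Omega$, $\partial_\pm\Omega=\{x\in\partial\Omega:\pm b\,n(x)>0\}$ ($-$ inflow, $+$ outflow). Mesh: $\mathcal{T}_h$ is a finite division of $\Omega$ into non-overlapping intervals covering $\Omega$, shape regular in the sense that any two neighboring intervals have comparable lengths up to the constant $\kappa_{\mathcal{T}_h}$. The set of vertices is $\mathcal{V}_h=\mathcal{V}_h^{\mathrm{int}}\cup\mathcal{V}_h^{\partial_-\Omega}\cup\mathcal{V}_h^{\partial_+\Omega}$ (interior, inflow and outflow vertices). For $a\in\mathcal{V}_h$, $\mathcal{T}_a$ is the set of elements having $a$ as a vertex, $\omega_a$ the corresponding open interval, $h_{\omega_a}$ its diameter, and $\psi_a$ the continuous piecewise affine hat function equal to $1$ at $a$ and $0$ at all other vertices. $\mathcal{P}^{k'}(\mathcal{T}_a)$ denotes piecewise polynomials of degree at most $k'$ on $\mathcal{T}_a$ (no continuity imposed). *)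

(* Defs.v *)
From mathcomp Require Import all_boot all_order all_algebra.
From mathcomp Require Import all_classical all_reals all_analysis.
From mathcomp Require Import ring lra.
Set Implicit Arguments.
Unset Strict Implicit.
Unset Printing Implicit Defensive.
Import Order.TTheory GRing.Theory Num.Theory.
Import numFieldNormedType.Exports.
Local Open Scope classical_set_scope.
Local Open Scope ring_scope.

(** Functions on a set [D] are represented by total functions [R -> R] of which
    only the (almost everywhere) values on [D] matter. *)

Definition L2 (R : realType) (D : set R) (v : R -> R) : Prop :=
  (v \_ D) \in Lfun (@lebesgue_measure R) 2%:E.

Definition ip (R : realType) (D : set R) (v w : R -> R) : R :=
  \int[@lebesgue_measure R]_(x in D) (v x * w x).

Definition nrm (R : realType) (D : set R) (v : R -> R) : R :=
  Num.sqrt (ip D v v).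

(** [C_c^infty(D)] for an open set [D]. *)
Definition test_function (R : realType) (D : set R) (phi : R -> R) : Prop :=
  [/\ forall n x, derivable (derive1n n phi) x 1,
      compact (closure [set x | phi x != 0])
    & closure [set x | phi x != 0] `<=` D].

Definition is_wderiv (R : realType) (D : set R) (v g : R -> R) : Prop :=
  forall phi, test_function D phi -> ip D v (derive1 phi) = - ip D g phi.

Definition H1 (R : realType) (D : set R) (v : R -> R) : Prop :=
  L2 D v /\ exists g, L2 D g /\ is_wderiv D v g.

(** The weak derivative of an element of [H1 D]: it is unique up to equality
    almost everywhere on [D], and some representative is chosen. The value is
    the junk value 0 when there is no square-integrable weak derivative. *)
Definition wderiv (R : realType) (D : set R) (v : R -> R) : R -> R :=
  xget (cst 0) [set g | L2 D g /\ is_wderiv D v g].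

(** A mesh of the interval [`]l, r[] is a sequence [s] such that
    [itv_partition l r s]: the vertices are the items of [l :: s], in increasing
    order, and are numbered from [0] to [size s]. *)
Section Mesh.
Context {R : realType} (l r : R) (s : seq R).

(** The default [r] makes [vtx (size s).+1 = vtx (size s) = r], so that the
    formula for [omega] below is also right at both end vertices. *)
Definition vtx (i : nat) : R := nth r (l :: s) i.

Definition elt (j : nat) : set R := [set` `]vtx j, vtx j.+1[].

Definition shape_regular (kappa : R) : Prop :=
  forall j, (j.+1 < size s)%N ->
    vtx j.+1 - vtx j <= kappa * (vtx j.+2 - vtx j.+1) /\
    vtx j.+2 - vtx j.+1 <= kappa * (vtx j.+1 - vtx j).

Definition interior_vertex (i : nat) : bool := (0 < i < size s)%N.

Definition boundary_vertex (i : nat) : bool := (i == 0%N) || (i == size s).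

Definition outward_normal (i : nat) : R := if i == 0%N then -1 else 1.

Definition inflow_vertex (b : R) (i : nat) : bool :=
  boundary_vertex i && (b * outward_normal i < 0).

Definition patch_elt (i j : nat) : bool :=
  (j < size s)%N && ((j == i) || (j.+1 == i)).

Definition omega (i : nat) : set R := [set` `]vtx i.-1, vtx i.+1[].

Definition h_omega (i : nat) : R := vtx i.+1 - vtx i.-1.

Definition hat (i : nat) (y : R) : R :=
  if (0 < i)%N && (vtx i.-1 <= y <= vtx i) then
    (y - vtx i.-1) / (vtx i - vtx i.-1)
  else if (i < size s)%N && (vtx i <= y <= vtx i.+1) then
    (vtx i.+1 - y) / (vtx i.+1 - vtx i)
  else 0.

(** Values at the vertices are left free, as they are negligible. *)
Definition broken_poly (k i : nat) (v : R -> R) : Prop :=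
  forall j, patch_elt i j ->
    exists2 p : {poly R}, (size p <= k.+1)%N & forall y, elt j y -> v y = p.[y].

Definition X_h (k i : nat) (v : R -> R) : Prop :=
  broken_poly k i v /\ H1 (omega i) v.

Definition local_solution (b : R) (k : nat) (f u : R -> R) (i : nat)
    (sh : R -> R) : Prop :=
  X_h k i sh /\
  forall v, broken_poly k i v ->
    ip (omega i) (fun x => b * wderiv (omega i) (hat i \* sh) x) v =
    ip (omega i)
       (fun x => f x * hat i x + b * wderiv (omega i) (hat i) x * u x) v.

Lemma vtx_lt i j : itv_partition l r s -> (i < j <= size s)%N -> vtx i < vtx j.
Proof.
move=> [ls _] /andP[ij js].
have := @sorted_ltn_nth _ <%R lt_trans r (l :: s) ls i j.
by rewrite !inE /= !ltnS; apply => //; exact: leq_trans (ltnW ij) js.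
Qed.

Lemma vtx_le i j : itv_partition l r s -> (i <= j <= size s)%N -> vtx i <= vtx j.
Proof.
move=> ls /andP[]; rewrite leq_eqVlt => /orP[/eqP -> //|ij js].
by apply/ltW/vtx_lt; rewrite ?ij.
Qed.

(** [hat i] is affine on each closed element, with the nodal values of the hat
    function; in particular it is continuous on the closure of the mesh. *)
Lemma hatP i : l < r -> itv_partition l r s -> (i <= size s)%N ->
  (forall j, (j <= size s)%N -> hat i (vtx j) = (j == i)%:R) /\
  (forall j, (j < size s)%N -> exists p q : R,
     forall y, vtx j <= y <= vtx j.+1 -> hat i y = p * y + q).
Proof.
move=> lr ls iN.
have vlt a c : (a < c <= size s)%N -> vtx a < vtx c by exact: vtx_lt.
have vle a c : (a <= c <= size s)%N -> vtx a <= vtx c by exact: vtx_le.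
have up : (0 < i)%N -> vtx i.-1 < vtx i.
  by move=> i0; apply: vlt; rewrite prednK// leqnn.
have dn : (i < size s)%N -> vtx i < vtx i.+1.
  by move=> i1; apply: vlt; rewrite ltnSn.
have aff j : (j < size s)%N -> exists p q : R,
    (forall y, vtx j <= y <= vtx j.+1 -> hat i y = p * y + q) /\
    p * vtx j + q = (j == i)%:R /\ p * vtx j.+1 + q = (j.+1 == i)%:R.
  move=> jN; have [ji|ij|ji] := ltngtP j i; last first.
  - subst j; have d := dn jN; have d0 : vtx i.+1 - vtx i != 0 by lra.
    exists (- (vtx i.+1 - vtx i)^-1), (vtx i.+1 / (vtx i.+1 - vtx i)).
    split; last by rewrite gtn_eqF// ?mulr1n ?mulr0n//; split; field.
    move=> y yi; rewrite /hat jN yi /=.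
    case: ifP => [/andP[i0 /andP[_ yi']]|_]; last by field.
    have -> : y = vtx i by apply/eqP; rewrite eq_le yi'; case/andP: yi.
    by have u := up i0; field; apply/andP; split; lra.
  - exists 0, 0; split; last by rewrite gtn_eqF ?ltnS ?(ltnW ij)// ?mulr0n; split; lra.
    move=> y /andP[y1 _]; rewrite /hat mul0r addr0.
    have ij1 : vtx i.+1 <= vtx j by apply: vle; rewrite ij ltnW.
    have d := dn (ltn_trans ij jN).
    rewrite [y <= vtx i]leNgt (lt_le_trans d (le_trans ij1 y1)) !andbF /=.
    case: ifP => // /andP[_ /andP[_ y2]].
    have -> : y = vtx i.+1 by lra.
    by rewrite subrr mul0r.
  - have i0 : (0 < i)%N by exact: leq_ltn_trans ji.
    have u := up i0.
    have [ji1|ji1] := eqVneq j.+1 i.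
      have jE : j = i.-1 by rewrite -ji1.
      rewrite ji1 jE; have d0 : vtx i - vtx i.-1 != 0 by lra.
      exists ((vtx i - vtx i.-1)^-1), (- (vtx i.-1) / (vtx i - vtx i.-1)).
      split; last by rewrite ?mulr1n ?mulr0n; split; field.
      by move=> y yi; rewrite /hat i0 yi /=; field.
    exists 0, 0; split; last by rewrite ?mulr0n; split; lra.
    have ji2 : (j.+1 < i)%N by rewrite ltn_neqAle ji1.
    have jv : vtx j.+1 <= vtx i.-1.
      apply: vle; rewrite -ltnS prednK// ji2 /=.
      exact: leq_trans (leq_pred _) iN.
    move=> y /andP[_ y1]; rewrite /hat mul0r addr0.
    rewrite [vtx i <= y]leNgt (le_lt_trans y1 (le_lt_trans jv u)) !andbF /=.
    case: ifP => // /andP[_ /andP[y2 _]].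
    have -> : y = vtx i.-1 by lra.
    by rewrite subrr mul0r.
split=> [j|j jN]; last by have [p [q [h _]]] := aff j jN; exists p, q.
rewrite leq_eqVlt => /orP[/eqP ->|jN]; last first.
  have [p [q [h [<- _]]]] := aff j jN; apply: h; rewrite lexx /=.
  by apply: vle; rewrite leqnSn.
have s0 : (0 < size s)%N.
  case: (posnP (size s)) => // /size0nil s0; move: lr ls; rewrite s0.
  by move=> lr /itv_partition_nil lr0; rewrite lr0 ltxx in lr.
have sN : ((size s).-1 < size s)%N by rewrite prednK.
have [p [q [h [_ h2]]]] := aff _ sN.
rewrite (prednK s0) in h h2; rewrite -h2.
by apply: h; rewrite lexx andbT; apply: vle; rewrite leq_pred leqnn.
Qed.
End Mesh.

(* Main.v *)
Require Import Defs.
From mathcomp Require Import all_boot all_order all_algebra.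
From mathcomp Require Import finmap.
From mathcomp Require Import all_classical all_reals all_analysis.
From mathcomp Require Import measurable_realfun ring lra.
Set Implicit Arguments.
Unset Strict Implicit.
Unset Printing Implicit Defensive.
Import Order.TTheory GRing.Theory Num.Theory.
Import numFieldNormedType.Exports.
Local Open Scope classical_set_scope.
Local Open Scope ring_scope.

(** Let [psi] be the hat function of a vertex and [K] an element of its patch.
    For a piecewise polynomial [s] of degree at most [k] without jump, the
    function [(psi s)'] is again a piecewise polynomial of degree at most [k],
    and since test functions need not be continuous, the local problem decouples
    into one square linear system on each [K], namely
    [int_K b (psi s)' v = int_K (f psi + b psi' u) v] for all polynomials [v] of
    degree at most [k].

    This system is governed by an energy identity ([elt_form_self]): testing with
    [s] and using that [psi] is affine, vanishes at one end of [K] and equals 1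
    at the other, one gets, up to sign,
    [2 int_K (psi s)' s = |K|^-1 * int_K s^2 + s(vertex)^2].
    Hence the system is injective, so uniquely solvable ([elt_exists],
    [elt_unique]), and the Cauchy-Schwarz inequality gives
    [nrm s <= 2 |K| / |b| * nrm f + 2 * nrm u] on [K] ([elt_stable]).

    It remains to match the two pieces at an interior vertex. Testing with the
    constant 1 shows that [b s(vertex)] and [- b s(vertex)] are the integrals of
    the load over the left and the right element ([elt_endpoint]), so that the
    two vertex values agree precisely when the load has zero mean on the patch,
    which is the orthogonality relation satisfied by [u].

    Passing between weak derivatives and piecewise derivatives requires two
    facts: a piecewise polynomial lies in [H1] only if it has no jump, and its
    weak derivative is then the piecewise one almost everywhere
    ([piecewise_H1_continuous], [piecewise_H1]). Both follow from the fundamental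
    lemma of the calculus of variations ([ae0_of_test_integral0]), proved with
    explicit smooth bumps built from [exp (- 1/x)]. *)

(** * Smooth compactly supported bumps *)

(** The functions [P (1/x) * exp (- 1/x)] on the positive half-line, extended
    by 0. They form a class stable under differentiation, because
    differentiating [1/x] yields a polynomial in [1/x]. *)
Definition tail (R : realType) (P : {poly R}) (x : R) : R :=
  if 0 < x then P.[x^-1] * expR (- x^-1) else 0.

(** Termwise, from [y ^ i <= i! * exp y]. *)
Lemma horner_le_expR (R : realType) (P : {poly R}) :
  exists2 C : R, 0 <= C & forall y, 0 <= y -> `|P.[y]| <= C * expR y.
Proof.
exists (\sum_(i < size P) `|P`_i| * i`!%:R).
  by apply: sumr_ge0 => i _; rewrite mulr_ge0.
move=> y y0; rewrite horner_coef (le_trans (ler_norm_sum _ _ _))// mulr_suml.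
apply: ler_sum => -[[|i] _] _ /=; rewrite normrM -mulrA ler_wpM2l//.
  by rewrite expr0 normr1 mul1r -expR0 ler_expR.
rewrite ger0_norm ?exprn_ge0//.
have := @expR_ge1Dxn R y i y0; have f0 : 0 < (i.+1)`!%:R :> R by rewrite ltr0n fact_gt0.
move=> h; rewrite mulrC -ler_pdivrMr//; lra.
Qed.

(** This quadratic bound is what makes the extension by 0 differentiable at the
    origin, with derivative 0. *)
Lemma tail_le_sqr (R : realType) (P : {poly R}) :
  exists2 C : R, 0 <= C & forall x, `|tail P x| <= C * x ^+ 2.
Proof.
have [C C0 PC] := horner_le_expR (P * 'X^2).
exists C => // x; rewrite /tail; case: ifPn => [x0|_]; last first.
  by rewrite normr0 mulr_ge0// sqr_ge0.
have := PC x^-1; rewrite invr_ge0 (ltW x0) => /(_ isT).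
have e0 := expR_gt0 x^-1; have x2 : 0 < x ^+ 2 by rewrite exprn_gt0.
rewrite hornerM hornerXn normrM exprVn normrM expRN.
rewrite (gtr0_norm (x := (x ^+ 2)^-1)) ?invr_gt0// (gtr0_norm (x := (expR x^-1)^-1)) ?invr_gt0//.
by move=> h; rewrite ler_pdivrMr// mulrAC -ler_pdivrMr.
Qed.

(** The polynomial [(P - P^`()) * 'X^2] comes from the chain rule in the variable
    [1/x]; at the origin both sides vanish by [tail_le_sqr]. *)
Lemma is_derive_tail (R : realType) (P : {poly R}) (x : R) :
  is_derive x 1 (tail P) (tail ((P - P^`()) * 'X^2) x).
Proof.
have [x0|x0|->] := ltgtP x 0.
- have -> : tail ((P - P^`()) * 'X^2) x = 0 by rewrite /tail ltNge ltW.
  apply: (@near_eq_is_derive _ _ _ (cst 0)) => //.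
  near=> y; rewrite /tail ltNge ltW//; near: y.
  exact: lt_nbhsl.
- apply: (@near_eq_is_derive R R^o R^o (fun x => P.[x^-1] * expR (- x^-1))).
  + near=> y; rewrite /tail ifT//; near: y; exact: lt_nbhsr.
  + have xn0 : x != 0 by rewrite gt_eqF.
    have dV : is_derive x (1:R) (fun y : R => y^-1) (- x ^- 2).
      have := @is_deriveV R id x 1 1 xn0 (is_derive_id _ _).
      by rewrite /GRing.scale/= mulr1.
    have dP := is_derive1_comp (is_derive_poly P x^-1) dV.
    have dN : is_derive x (1:R) (fun y : R => - y^-1) (x ^- 2).
      by rewrite -[x ^- 2]opprK; exact: is_deriveN.
    have dE := @is_derive1_comp R expR (fun y => - y^-1) x _ _ (is_derive_expR _) dN.
    have := is_deriveM dP dE; rewrite /comp => /trigger_derive; apply.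
    by rewrite /tail x0 /GRing.scale/= hornerM hornerXn hornerD hornerN; field.
- rewrite (_ : tail (_ * _) 0 = 0); last by rewrite /tail ltxx.
  have [C C0 PC] := tail_le_sqr P.
  have t0 : tail P 0 = 0 by rewrite /tail ltxx.
  suff h : h^-1 *: (tail P (h *: 1 + 0) - tail P 0) @[h --> 0^'] --> (0:R).
    apply: DeriveDef; last exact/cvg_lim.
    by apply/cvg_ex; exists 0.
  apply/cvgr0Pnorm_le => e e0.
  have eC : 0 < e / (C + 1) by rewrite divr_gt0// ltr_wpDl.
  near=> h.
  have hn0 : h != 0 by near: h; exact: nbhs_dnbhs_neq.
  rewrite t0 subr0 addr0 /GRing.scale/= mulr1 normrM normfV.
  rewrite mulrC ler_pdivrMr ?normr_gt0// (le_trans (PC h))//.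
  rewrite -(real_normK (num_real h)) expr2 mulrA ler_wpM2r//.
  rewrite (@le_trans _ _ ((C + 1) * `|h|))// ?ler_wpM2r ?lerDl//.
  rewrite mulrC -ler_pdivlMr ?ltr_wpDl//.
  by near: h; exact: dnbhs0_le.
Unshelve. all: by end_near.
Qed.

(** A differentiation-stable space of functions that contains the bumps below:
    stability replaces an explicit formula for the iterated derivatives. *)
Inductive bump_span (R : realType) : (R -> R) -> Prop :=
| bump_span1 P Q c n p q :
    bump_span (fun x => c * (tail P (n * (x - p)) * tail Q (n * (q - x))))
| bump_spanD f g : bump_span f -> bump_span g -> bump_span (f + g).

Lemma bump_span_derive (R : realType) (f : R -> R) : bump_span f ->
  (forall x, derivable f x 1) /\ bump_span (derive1 f).
Proof.
elim=> {f} [P Q c n p q|f g _ [df sf] _ [dg sg]]; last first.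
  split=> [x|]; first exact: derivableD.
  have -> : derive1 (f + g) = derive1 f + derive1 g.
    by apply/funext => x; rewrite derive1E deriveD// -!derive1E.
  exact: bump_spanD.
pose P' := (P - P^`()) * 'X^2; pose Q' := (Q - Q^`()) * 'X^2.
have dp (x : R) : is_derive x 1 (fun x : R => n * (x - p)) n.
  apply: trigger_derive; rewrite /GRing.scale/=; ring.
have dq (x : R) : is_derive x 1 (fun x : R => n * (q - x)) (- n).
  apply: trigger_derive; rewrite /GRing.scale/=; ring.
have d (x : R) : is_derive x (1 : R)
    (fun x => c * (tail P (n * (x - p)) * tail Q (n * (q - x))))
    (c * n * (tail P' (n * (x - p)) * tail Q (n * (q - x))) +
     - (c * n) * (tail P (n * (x - p)) * tail Q' (n * (q - x)))).
  have := is_deriveZ c (is_deriveM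
    (@is_derive1_comp R _ (fun x => n * (x - p)) x _ _ (is_derive_tail P _) (dp x))
    (@is_derive1_comp R _ (fun x => n * (q - x)) x _ _ (is_derive_tail Q _) (dq x))).
  by move/trigger_derive; apply; rewrite /GRing.scale/= /P' /Q'; ring.
split=> [x|]; first by case: (d x).
rewrite (_ : derive1 _ = (fun x => c * n * (tail P' (n * (x - p)) * tail Q (n * (q - x)))) +
     (fun x => - (c * n) * (tail P (n * (x - p)) * tail Q' (n * (q - x))))).
  by apply: bump_spanD; exact: bump_span1.
by apply/funext => x; rewrite derive1E derive_val.
Qed.

Lemma bump_span_smooth (R : realType) (f : R -> R) : bump_span f ->
  forall n x, derivable (derive1n n f) x 1.
Proof.
move=> sf n; suff /bump_span_derive[] : bump_span (derive1n n f) by [].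
by elim: n => [//|n IH]; rewrite derive1nS; exact: (bump_span_derive IH).2.
Qed.

(** Since [exp (- 1/(n y))] tends to 1 for every [y > 0], these functions tend to
    the indicator of [`]p, q[] while staying between 0 and 1. *)
Definition smooth_bump (R : realType) (p q : R) (n : nat) (x : R) : R :=
  tail 1 (n.+1%:R * (x - p)) * tail 1 (n.+1%:R * (q - x)).

Lemma smooth_bump_supp (R : realType) (p q x : R) n :
  (smooth_bump p q n x != 0) = (p < x < q).
Proof.
have t y : (tail 1 y != 0) = (0 < y :> R).
  by rewrite /tail hornerC mul1r; case: ifP => _; rewrite ?eqxx// gt_eqF// expR_gt0.
by rewrite /smooth_bump mulf_eq0 negb_or !t !pmulr_rgt0 ?ltr0n// !subr_gt0.
Qed.

Lemma smooth_bump_test (R : realType) (a c p q : R) n : a < p -> q < c ->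
  test_function `]a, c[ (smooth_bump p q n).
Proof.
move=> ap qc.
have cl : closure [set x | smooth_bump p q n x != 0] `<=` `[p, q].
  rewrite [X in _ `<=` X](closure_id _).1; last exact: itv_closed.
  by apply: closureS => x /=; rewrite smooth_bump_supp in_itv/= => /andP[/ltW -> /ltW].
split.
- have sb : bump_span (smooth_bump p q n).
    have := bump_span1 1 1 1 n.+1%:R p q; congr bump_span.
    by apply/funext => x; rewrite mul1r.
  exact: bump_span_smooth.
- apply: subclosed_compact cl; last exact: segment_compact.
  exact: closed_closure.
- apply: (subset_trans cl) => x /=; rewrite !in_itv/= => /andP[px xq].
  by rewrite (lt_le_trans ap px) (le_lt_trans xq qc).
Qed.

Lemma smooth_bump_ge0_le1 (R : realType) (p q x : R) n : 0 <= smooth_bump p q n x <= 1.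
Proof.
have t y : 0 <= tail 1 y <= (1 : R).
  rewrite /tail hornerC mul1r; case: ifP => y0; rewrite ?lexx ?ler01// expR_ge0 /=.
  by rewrite -expR0 ler_expR oppr_le0 invr_ge0 ltW.
have /andP[t1 t2] := t (n.+1%:R * (x - p)).
have /andP[t3 t4] := t (n.+1%:R * (q - x)).
by rewrite mulr_ge0//= mulr_ile1.
Qed.

Lemma smooth_bump_cvg (R : realType) (p q x : R) :
  smooth_bump p q n x @[n --> \oo] --> (\1_`]p, q[ x : R).
Proof.
have t (y : R) : (fun n : nat => tail 1 (n.+1%:R * y : R)) @ \oo --> ((0 < y)%R%:R : R).
  rewrite /tail.
  have [y0|y0] := ltP 0 y.
    under eq_fun do rewrite hornerC mul1r pmulr_rgt0 ?ltr0n// y0 invfM.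
    have -> : true%:R = expR (- (0 * y^-1)) by rewrite mul0r oppr0 expR0.
    apply: continuous_cvg; first exact: continuous_expR.
    apply: cvgN; apply: cvgMr_tmp; exact: cvg_harmonic.
  under eq_fun do rewrite pmulr_rgt0 ?ltr0n// ltNge y0 /=.
  exact: cvg_cst.
rewrite indicE mem_setE in_itv/= -[p < x]subr_gt0 -[x < q]subr_gt0.
by rewrite -mulnb natrM; apply: cvgM; exact: t.
Qed.

(** * The fundamental lemma of the calculus of variations *)
Section FundamentalLemma.
Context {R : realType}.
Local Notation mu := (@lebesgue_measure R).

Lemma measurable_fun_derivable (D : set R) (f : R -> R) :
  (forall x, derivable f x 1) -> measurable_fun D f.
Proof.
move=> df; apply: measurable_funTS; apply: continuous_measurable_fun => x.
exact/differentiable_continuous/derivable1_diffP.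
Qed.

(** The primitive of [w] is constant on [`]a, c[], and by Lebesgue's
    differentiation theorem its derivative is [w] almost everywhere. *)
Lemma ae0_of_itv_integral0 (a c : R) (w : R -> R) :
  mu.-integrable `]a, c[ (EFin \o w) ->
  (forall p q, a < p -> p < q -> q < c ->
    \int[mu]_(x in `]p, q[) w x = 0) ->
  {ae mu, forall x, x \in `]a, c[ -> w x = 0}.
Proof.
move=> iw w0.
pose g := w \_ `]a, c[.
have ig A : measurable A -> mu.-integrable A (EFin \o g).
  move=> mA; apply: (@integrableS _ _ _ _ setT) => //.
  rewrite /g -restrict_EFin.
  exact: (@integrable_mkcond _ _ _ mu `]a, c[ (EFin \o w) (measurable_itv _)).1.
have lg : locally_integrable setT g.
  by apply: integrable_locally.
have := FTC1Ny (fun y => ig [set` `]-oo, y]] (measurable_itv _)) lg.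
apply: filterS; first exact: (ae_filter_ringOfSetsType mu).
move=> x /=; set F := fun y => _ => -[dF FE] xac.
have <- : g x = w x by rewrite /g patchE mem_set.
rewrite -FE derive1E.
move: xac; rewrite in_itv/= => /andP[ax xc].
pose m := (a + x) / 2; have am : a < m by rewrite /m; lra.
have mx : m < x by rewrite /m; lra.
suff : \near x, F x = cst (F m) x.
  by move=> h; rewrite (near_eq_derive (1:R^o) h) derive_cst.
near=> y.
have ay : m < y by near: y; exact: lt_nbhsr.
have yc : y < c by near: y; exact: lt_nbhsl.
apply/eqP; rewrite -subr_eq0 /F /cst /=.
rewrite Rintegral_itvB ?bnd_simp//; [|exact: ig|exact: ltW].
rewrite -Rintegral_itv_bndo_bndc; last exact: ig.
rewrite -(w0 m y); [|lra..].
apply/eqP/eq_Rintegral => z; rewrite inE/= in_itv/= => /andP[? ?].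
by rewrite /g patchE mem_set//= in_itv/=; apply/andP; split; lra.
Unshelve. all: by end_near.
Qed.

(** Testing with the bumps and passing to the limit by dominated convergence
    shows that the integral of [w] over every interval compactly contained in
    [`]a, c[] is 0. *)
Lemma ae0_of_test_integral0 (a c : R) (w : R -> R) :
  mu.-integrable `]a, c[ (EFin \o w) ->
  (forall phi, test_function `]a, c[ phi -> ip `]a, c[ w phi = 0) ->
  {ae mu, forall x, x \in `]a, c[ -> w x = 0}.
Proof.
move=> iw wphi.
apply: ae0_of_itv_integral0 => // p q ap pq qc.
have b1 n x : `|smooth_bump p q n x| <= 1.
  by have /andP[? ?] := smooth_bump_ge0_le1 p q x n; rewrite ger0_norm.
have mb n D : measurable_fun D (smooth_bump p q n).
  apply: measurable_fun_derivable.
  by have [/(_ 0%N)] := smooth_bump_test n ap qc.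
have mw : measurable_fun `]a, c[ w by apply/measurable_EFinP; exact: (measurable_int mu iw).
have [] := @dominated_convergence _ _ R mu `]a, c[ (measurable_itv _)
  (fun n x => (w x * smooth_bump p q n x)%:E) (fun x => (w x * \1_`]p, q[ x)%:E)
  (fun x => `|w x|%:E).
- by move=> n; apply/measurable_EFinP; exact: measurable_funM mw (mb n _).
- by apply/measurable_EFinP; apply: measurable_funM => //; exact: measurable_indic.
- apply/aeW => x _; apply: cvg_EFin; first exact: nearW.
  apply: cvgM; first exact: cvg_cst.
  exact: smooth_bump_cvg.
- exact: integrable_norm.
- apply/aeW => x n _; rewrite lee_fin normrM.
  by rewrite ler_piMr.
move=> _ _ cv.
have iwb n : mu.-integrable `]a, c[ (EFin \o (fun x => w x * smooth_bump p q n x)).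
  apply: (le_integrable _ _ _ (integrable_norm iw)) => //.
    by apply/measurable_EFinP; exact: measurable_funM mw (mb n _).
  by move=> x _ /=; rewrite lee_fin normr_id normrM ler_piMr.
have i0 n : (\int[mu]_(x in `]a, c[) (w x * smooth_bump p q n x)%:E = 0)%E.
  rewrite -[LHS]fineK; last exact: (integrable_fin_num _ (iwb n)).
  by congr (_%:E); exact/wphi/smooth_bump_test.
have := cvg_unique (@ereal_hausdorff R) cv; under eq_fun do rewrite i0.
move=> /(_ _ 0%E (cvg_cst _)) H.
have -> : \int[mu]_(x in `]p, q[) w x = fine (\int[mu]_(x in `]a, c[) (w x * \1_`]p, q[ x)%:E).
  rewrite [in LHS](_ : [set` `]p, q[] = `]a, c[ `&` `]p, q[).
    rewrite Rintegral_mkcondr; apply: eq_Rintegral => x _.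
    by rewrite patchE indicE /=; case: (_ \in _); rewrite ?mulr1 ?mulr0.
  apply/seteqP; split=> x /=; rewrite !in_itv/=; last by case.
  by move=> /andP[? ?]; split; apply/andP; split=> //; lra.
by rewrite H.
Qed.

End FundamentalLemma.

(** * Integrals and square-integrable functions on intervals *)
Section Integrals.
Context {R : realType}.
Local Notation mu := (@lebesgue_measure R).
Implicit Types (a m c : R) (f g v w : R -> R) (p q : {poly R}).

Lemma integrable_scale a c k g : mu.-integrable `]a, c[ (EFin \o g) ->
  mu.-integrable `]a, c[ (EFin \o (fun x => k * g x)).
Proof.
move=> ig; have := @integrableZl _ _ R mu `]a, c[ (measurable_itv _) k _ ig.
by apply: eq_integrable.
Qed.

Lemma integrable_add a c f g : mu.-integrable `]a, c[ (EFin \o f) ->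
  mu.-integrable `]a, c[ (EFin \o g) ->
  mu.-integrable `]a, c[ (EFin \o (fun x => f x + g x)).
Proof.
move=> i1 i2; have := @integrableD _ _ R mu `]a, c[ (measurable_itv _) _ _ i1 i2.
by apply: eq_integrable.
Qed.

Lemma integrable_itvU a m c f : a < m -> m < c ->
  mu.-integrable `]a, m[ (EFin \o f) -> mu.-integrable `]m, c[ (EFin \o f) ->
  mu.-integrable `]a, c[ (EFin \o f).
Proof.
move=> am mc i1 i2.
have M D : measurable D -> mu.-integrable D (EFin \o f) ->
    mu.-integrable setT ((EFin \o f) \_ D).
  by move=> mD; exact: (@integrable_mkcond _ _ _ mu D (EFin \o f) mD).1.
apply: (@integrable_mkcond _ _ _ mu `]a, c[ (EFin \o f) (measurable_itv _)).2.
have i3 : mu.-integrable [set m] (EFin \o f).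
  apply/integrableP; split; first exact: measurable_fun_set1.
  by rewrite integral_set1.
have := integrableD measurableT (integrableD measurableT
   (M _ (measurable_itv _) i1) (M _ (measurable_itv _) i2)) (M _ (measurable_set1 m) i3).
apply: eq_integrable => // x _; rewrite /= !patchE.
have -> : (x \in `]a, m[%classic) = (a < x < m) by rewrite mem_setE in_itv.
have -> : (x \in `]m, c[%classic) = (m < x < c) by rewrite mem_setE in_itv.
have -> : (x \in `]a, c[%classic) = (a < x < c) by rewrite mem_setE in_itv.
have -> : (x \in [set m]) = (x == m) by apply/idP/eqP; rewrite inE.
have [xm|xm|->] := ltgtP x m; rewrite ?andbF ?andbT ?am ?mc /=.
- by rewrite (lt_trans xm mc) andbT !adde0.
- by rewrite (lt_trans am xm) add0e adde0.
- by rewrite !add0e.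
Qed.

Lemma Rintegral_itvU a m c f : a < m -> m < c ->
  mu.-integrable `]a, c[ (EFin \o f) ->
  \int[mu]_(x in `]a, c[) f x =
  \int[mu]_(x in `]a, m[) f x + \int[mu]_(x in `]m, c[) f x.
Proof.
move=> am mc i.
have := @Rintegral_itvB R f (BRight a) (BLeft c) m i.
rewrite !bnd_simp (ltW am) mc => /(_ isT isT) <-.
rewrite -Rintegral_itv_bndo_bndc; first by rewrite addrC subrK.
apply: integrableS i => // x /=; rewrite !in_itv/= => /andP[-> /=] xm.
exact: lt_trans mc.
Qed.

Lemma integrable_itvS a c a' c' f : a <= a' -> c' <= c ->
  mu.-integrable `]a, c[ (EFin \o f) -> mu.-integrable `]a', c'[ (EFin \o f).
Proof.
by move=> aa cc; apply: integrableS => //; exact: subset_itvW.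
Qed.

(** Square-integrability in terms of [v] on the interval itself, instead of its
    extension by 0 to the whole line. *)
Lemma L2P a c v : L2 `]a, c[ v <->
  measurable_fun `]a, c[ v /\ mu.-integrable `]a, c[ (EFin \o (fun x => v x ^+ 2)).
Proof.
have sqE : EFin \o (fun x => (v \_ `]a, c[) x ^+ 2) =
    (EFin \o (fun x => v x ^+ 2)) \_ `]a, c[.
  apply/funext => x; rewrite /= !patchE; case: ifP => _ //.
  by rewrite /point/= expr0n.
split=> [v2|[mv iv]].
  split.
    apply: (measurable_restrictT v (measurable_itv `]a, c[)).2.
    by have := sub_Lfun_mfun v2; rewrite inE.
  have := Lfun2_integrable_sqr v2; rewrite sqE => ?.
  exact: (@integrable_mkcond _ _ _ mu `]a, c[ _ (measurable_itv _)).2.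
have mr : measurable_fun setT (v \_ `]a, c[).
  exact: (measurable_restrictT v (measurable_itv `]a, c[)).1.
rewrite /L2 inE; apply/andP; split; first by rewrite inE.
rewrite inE/= /finite_norm unlock /Lnorm poweR_lty//.
have /integrableP[_] := (@integrable_mkcond _ _ _ mu `]a, c[ _ (measurable_itv _)).1 iv.
apply: le_lt_trans; rewrite -sqE le_eqVlt; apply/orP; left; apply/eqP.
by apply: eq_integral => x _ /=; rewrite normrX powR_mulrn.
Qed.

Lemma L2_measurable a c v : L2 `]a, c[ v -> measurable_fun `]a, c[ v.
Proof. by move/L2P => []. Qed.

Lemma L2_mul_integrable a c v w : L2 `]a, c[ v -> L2 `]a, c[ w ->
  mu.-integrable `]a, c[ (EFin \o (fun x => v x * w x)).
Proof.
move=> v2 w2; have /Lfun1_integrable vw := Lfun2_mul_Lfun1 v2 w2.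
apply: (@integrable_mkcond _ _ _ mu `]a, c[ _ (measurable_itv _)).2.
apply: eq_integrable vw => // x _; rewrite /= !patchE.
by case: ifP => _ //; rewrite mulr0.
Qed.

Lemma L2_continuous a c v : continuous v -> L2 `]a, c[ v.
Proof.
move=> cv; apply/L2P; split.
  apply: measurable_funTS; exact: continuous_measurable_fun.
apply: (@integrableS _ _ _ mu [set` `[a, c]]) => //; first exact: subset_itv_oo_cc.
apply: continuous_compact_integrable; first exact: segment_compact.
apply: continuous_subspaceT => x; apply: cvgM; exact: cv.
Qed.

Lemma horner_L2 a c p : L2 `]a, c[ (horner p).
Proof. exact/L2_continuous/continuous_horner. Qed.

Lemma L2_integrable a c v : L2 `]a, c[ v -> mu.-integrable `]a, c[ (EFin \o v).
Proof.
move=> v2; have := L2_mul_integrable v2 (L2_continuous a c (@cst_continuous R R 1)).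
by apply: eq_integrable => // x _; rewrite /= mulr1.
Qed.

Lemma continuous_integrable a c f : continuous f ->
  mu.-integrable `]a, c[ (EFin \o f).
Proof. by move=> cf; exact/L2_integrable/L2_continuous. Qed.

Lemma L2S a c a' c' v : a <= a' -> c' <= c -> L2 `]a, c[ v -> L2 `]a', c'[ v.
Proof.
move=> aa cc /L2P[mv iv]; apply/L2P; split; last exact: integrable_itvS iv.
by apply: measurable_funS mv => //; exact: subset_itvW.
Qed.

Lemma L2U a m c v : a < m -> m < c -> L2 `]a, m[ v -> L2 `]m, c[ v -> L2 `]a, c[ v.
Proof.
move=> am mc /L2P[mv1 i1] /L2P[mv2 i2]; apply/L2P; split; last exact: integrable_itvU i2.
have mU : measurable_fun (`]a, m[ `|` [set m] `|` `]m, c[) v.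
  apply/measurable_funU => //; first exact: measurableU.
  split=> //; apply/measurable_funU => //; split=> //; exact: measurable_fun_set1.
apply: measurable_funS mU; first by do 2 apply: measurableU => //.
move=> x /=; rewrite !in_itv/= => /andP[ax xc].
by have [xm|xm|->] := ltgtP x m; [left; left; rewrite ax|right|left; right].
Qed.

Lemma L2_eq a c v w : (forall x, a < x < c -> v x = w x) -> L2 `]a, c[ v -> L2 `]a, c[ w.
Proof.
move=> vw; rewrite /L2 => vL; rewrite (_ : w \_ _ = v \_ `]a, c[)//; apply/funext => x; rewrite !patchE.
by case: ifP => //; rewrite mem_setE in_itv/= => /vw.
Qed.

Lemma L2B a c v w : L2 `]a, c[ v -> L2 `]a, c[ w -> L2 `]a, c[ (v \- w).
Proof.
rewrite /L2 => v2 w2; rewrite (_ : _ \_ _ = v \_ `]a, c[ - w \_ `]a, c[).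
  have p1 : (1 <= 2%:E :> \bar R)%E by rewrite lee_fin ler1n.
  exact: (Lfun_addr_closed mu p1).2 v2 (Lfun_oppr_closed w2).
by apply/funext => x; rewrite !fctE !patchE; case: ifP => // _; rewrite subr0.
Qed.

Lemma ipC D v w : ip D v w = ip D w v.
Proof. by apply: eq_Rintegral => x _; rewrite mulrC. Qed.

Lemma ip_ge0 D v : 0 <= ip D v v.
Proof. by apply: Rintegral_ge0 => x _; rewrite -expr2 sqr_ge0. Qed.

Lemma nrm_sqr D v : nrm D v ^+ 2 = ip D v v.
Proof. by rewrite /nrm sqr_sqrtr// ip_ge0. Qed.

Lemma ip_subl a c v w z : L2 `]a, c[ v -> L2 `]a, c[ w -> L2 `]a, c[ z ->
  ip `]a, c[ (v \- w) z = ip `]a, c[ v z - ip `]a, c[ w z.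
Proof.
move=> v2 w2 z2; rewrite /ip -RintegralB//; [|exact: L2_mul_integrable..].
by apply: eq_Rintegral => x _ /=; rewrite mulrBl.
Qed.

(** Only measurability is assumed, so that a weak derivative can be replaced by
    an explicit representative before any integrability of the product is
    known. *)
Lemma ip_ae a c w w' z : measurable_fun `]a, c[ w -> measurable_fun `]a, c[ w' ->
  measurable_fun `]a, c[ z -> {ae mu, forall x, x \in `]a, c[ -> w x = w' x} ->
  ip `]a, c[ w z = ip `]a, c[ w' z.
Proof.
move=> mw mw' mz ww; rewrite /ip /Rintegral; congr fine.
apply: ae_eq_integral => //.
- by apply/measurable_EFinP; exact: measurable_funM mw mz.
- by apply/measurable_EFinP; exact: measurable_funM mw' mz.
- move: ww; apply: filterS; first exact: (ae_filter_ringOfSetsType mu).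
  by move=> x /= h xK; rewrite h.
Qed.

(** The quadratic [t |-> ip (v + t w) (v + t w)] is nonnegative, so its
    discriminant is nonpositive. *)
Lemma cauchy_schwarz a c v w : L2 `]a, c[ v -> L2 `]a, c[ w ->
  `|ip `]a, c[ v w| <= nrm `]a, c[ v * nrm `]a, c[ w.
Proof.
move=> v2 w2; set A := ip `]a, c[ v v; set B := ip _ _ _; set C := ip `]a, c[ w w.
have H (t : R) : 0 <= A + 2 * t * B + t ^+ 2 * C.
  have -> : A + 2 * t * B + t ^+ 2 * C = \int[mu]_(x in `]a, c[) ((v x + t * w x) * (v x + t * w x)).
    rewrite /A /B /C /ip -!RintegralZl//; [|exact: L2_mul_integrable..].
    have iZ := @integrable_scale a c.
    rewrite -!RintegralD//.
    - by apply: eq_Rintegral => x _; ring.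
    - apply: integrable_add; first exact: L2_mul_integrable.
      exact/iZ/L2_mul_integrable.
    - exact/iZ/L2_mul_integrable.
    - exact: L2_mul_integrable.
    - exact/iZ/L2_mul_integrable.
  by apply: Rintegral_ge0 => x _; rewrite -expr2 sqr_ge0.
have A0 : 0 <= A by exact: ip_ge0.
have C0 : 0 <= C by exact: ip_ge0.
rewrite /nrm -/A -/C -sqrtrM// -sqrtr_sqr ler_wsqrtr//.
have [C00|Cn0] := eqVneq C 0.
  (* the quadratic is affine here: a nonzero slope would make it reach -1 *)
  rewrite C00 mulr0; have [->|Bn0] := eqVneq B 0; first by rewrite expr0n.
  have := H (- (A + 1) / (2 * B)); rewrite C00 mulr0 addr0.
  have -> : A + 2 * (- (A + 1) / (2 * B)) * B = - 1 by field.
  by lra.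
have Cp : 0 < C by rewrite lt_neqAle eq_sym Cn0.
(* the minimum of the quadratic is attained at - B / C *)
have := H (- B / C).
have -> : A + 2 * (- B / C) * B + (- B / C) ^+ 2 * C = (A * C - B ^+ 2) / C by field.
by rewrite pmulr_lge0 ?invr_gt0 ?subr_ge0.
Qed.

Lemma Rintegral_derive a c (F f : R -> R) : a < c ->
  (forall x : R, is_derive x (1 : R) F (f x)) -> continuous f ->
  \int[mu]_(x in `]a, c[) f x = F c - F a.
Proof.
move=> ac dF cf.
have cF : continuous F.
  by move=> x; apply/differentiable_continuous/derivable1_diffP; case: (dF x).
have ii : mu.-integrable `[a, c] (EFin \o f).
  apply: continuous_compact_integrable; first exact: segment_compact.
  exact: continuous_subspaceT.
rewrite Rintegral_itv_bndo_bndc; last first.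
  by apply: integrableS ii => //; exact: subset_itv_oo_cc.
rewrite Rintegral_itv_obnd_cbnd; last first.
  by apply: integrableS ii => //; exact: subset_itv_oc_cc.
rewrite /Rintegral (@continuous_FTC2 _ f F)//.
- exact: continuous_subspaceT.
- split=> [x _||]; first by case: (dF x).
    exact/cvg_at_right_filter/cF.
  exact/cvg_at_left_filter/cF.
- by move=> x _; rewrite derive1E; case: (dF x).
Qed.

End Integrals.

(** * Weak derivatives of piecewise polynomials *)
Section WeakDerivative.
Context {R : realType}.
Local Notation mu := (@lebesgue_measure R).
Implicit Types (a m c : R) (f g v w phi : R -> R) (p q : {poly R}).

(** The support is contained in the open interval, so that test functions vanish
    at its end points: no boundary term survives in integrations by parts. *)
Lemma test_function_out a c phi x : test_function `]a, c[ phi ->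
  ~~ (a < x < c) -> phi x = 0.
Proof.
move=> [_ _ sub] xn; apply/eqP; apply: contraNT xn => px.
have /sub : closure [set x | phi x != 0] x by exact: subset_closure.
by rewrite /= in_itv.
Qed.

Lemma test_functionS a c a' c' phi : a <= a' -> c' <= c ->
  test_function `]a', c'[ phi -> test_function `]a, c[ phi.
Proof.
move=> aa cc [? ? sub]; split=> //; apply: subset_trans sub _.
exact: subset_itvW.
Qed.

Lemma test_function_continuous a c phi : test_function `]a, c[ phi ->
  continuous phi /\ continuous (derive1 phi).
Proof.
move=> [d _ _]; split=> x; apply/differentiable_continuous/derivable1_diffP.
  exact: (d 0%N).
exact: (d 1%N).
Qed.

Lemma is_derive_test a c phi (x : R) : test_function `]a, c[ phi ->
  is_derive x (1 : R) phi (derive1 phi x).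
Proof. by move=> [d _ _]; rewrite derive1E; exact/derivableP/(d 0%N). Qed.

(** The interval of integration may be smaller than the one carrying [phi]: on
    each half of a patch a boundary term at the common vertex remains. *)
Lemma poly_test_by_parts a c a' c' p phi : a' < c' -> test_function `]a, c[ phi ->
  \int[mu]_(x in `]a', c'[) (p.[x] * derive1 phi x) =
  p.[c'] * phi c' - p.[a'] * phi a' - \int[mu]_(x in `]a', c'[) (p^`().[x] * phi x).
Proof.
move=> ac tphi; have [c0 c1] := test_function_continuous tphi.
have cp q := @continuous_horner R q.
have i1 : mu.-integrable `]a', c'[ (EFin \o (fun x => p.[x] * derive1 phi x)).
  by apply: continuous_integrable => x; apply: cvgM; [exact: cp|exact: c1].
have i2 : mu.-integrable `]a', c'[ (EFin \o (fun x => p^`().[x] * phi x)).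
  by apply: continuous_integrable => x; apply: cvgM; [exact: cp|exact: c0].
apply/eqP; rewrite eq_sym subr_eq -RintegralD//; apply/eqP.
apply/esym; apply: (@Rintegral_derive R a' c' (fun x => p.[x] * phi x)
  (fun x => p.[x] * derive1 phi x + p^`().[x] * phi x)) => // x.
  have := is_deriveM (is_derive_poly p x) (is_derive_test x tphi).
  by move/trigger_derive; apply; rewrite /GRing.scale/=; ring.
by apply: cvgD; apply: cvgM; [exact: cp|exact: c1|exact: cp|exact: c0].
Qed.

(** The value at the break point is left free, as in the broken spaces. *)
Definition piecewise a m c f1 f2 v : Prop :=
  {in `]a, m[, v =1 f1} /\ {in `]m, c[, v =1 f2}.

Definition glue m f1 f2 (x : R) : R := if x < m then f1 x else f2 x.

Lemma glueP a m c f1 f2 : piecewise a m c f1 f2 (glue m f1 f2).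
Proof.
split=> x; rewrite in_itv/= => /andP[h1 h2]; rewrite /glue ?h2//.
by rewrite ltNge (ltW h1).
Qed.

Lemma piecewise_L2 a m c f1 f2 v : a < m -> m < c -> continuous f1 -> continuous f2 ->
  piecewise a m c f1 f2 v -> L2 `]a, c[ v.
Proof.
move=> am mc c1 c2 [v1 v2]; apply: (L2U am mc).
  by apply: L2_eq (L2_continuous a m c1) => x xam; rewrite v1// in_itv.
by apply: L2_eq (L2_continuous m c c2) => x xam; rewrite v2// in_itv.
Qed.

Lemma ip_piecewise a m c f1 f2 v w : a < m -> m < c -> continuous f1 -> continuous f2 ->
  L2 `]a, c[ w -> piecewise a m c f1 f2 v ->
  ip `]a, c[ w v = ip `]a, m[ w f1 + ip `]m, c[ w f2.
Proof.
move=> am mc c1 c2 w2 pv; rewrite /ip (Rintegral_itvU am mc); last first.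
  exact/L2_mul_integrable/(piecewise_L2 am mc c1 c2 pv).
case: pv => v1 v2; congr (_ + _); apply: eq_Rintegral => x; rewrite inE => xK.
  by rewrite (v1 x xK).
by rewrite (v2 x xK).
Qed.

(** The distributional derivative of a piecewise polynomial is its piecewise
    derivative plus a Dirac mass at the break point, weighted by the jump. *)
Lemma piecewise_jump a m c p1 p2 v phi : a < m -> m < c ->
  piecewise a m c (horner p1) (horner p2) v -> test_function `]a, c[ phi ->
  ip `]a, c[ v (derive1 phi) = (p1.[m] - p2.[m]) * phi m
    - ip `]a, c[ (glue m (horner p1^`()) (horner p2^`())) phi.
Proof.
move=> am mc pv tphi; have [c0 c1] := test_function_continuous tphi.
have cp q := @continuous_horner R q.
rewrite ipC (ip_piecewise am mc (cp _) (cp _) (L2_continuous _ _ c1) pv).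
rewrite [X in _ - X]ipC (ip_piecewise am mc (cp _) (cp _) (L2_continuous _ _ c0) (glueP _ _ _ _ _)).
rewrite !(ipC _ (derive1 phi)) !(ipC _ phi) /ip !(poly_test_by_parts _ _ tphi)//.
rewrite (@test_function_out a c phi a)// ?ltxx// (@test_function_out a c phi c)// ?ltxx ?andbF//.
ring.
Qed.

Lemma is_wderiv_unique a c v g1 g2 : L2 `]a, c[ g1 -> L2 `]a, c[ g2 ->
  is_wderiv `]a, c[ v g1 -> is_wderiv `]a, c[ v g2 ->
  {ae mu, forall x, x \in `]a, c[ -> g1 x = g2 x}.
Proof.
move=> l1 l2 w1 w2.
have : {ae mu, forall x, x \in `]a, c[ -> (g1 \- g2) x = 0}.
  apply: ae0_of_test_integral0; first exact/L2_integrable/L2B.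
  move=> phi tphi; have [c0 _] := test_function_continuous tphi.
  rewrite ip_subl//; last exact: L2_continuous.
  by have := w1 _ tphi; rewrite (w2 _ tphi); lra.
apply: filterS; first exact: (ae_filter_ringOfSetsType mu).
by move=> x h /h /eqP; rewrite subr_eq0 => /eqP.
Qed.

Lemma glue_L2 a m c p1 p2 : a < m -> m < c -> L2 `]a, c[ (glue m (horner p1) (horner p2)).
Proof.
by move=> am mc; apply: piecewise_L2 (glueP _ _ _ _ _) => //; exact: continuous_horner.
Qed.

(** Without a jump the Dirac mass disappears; hence the weak derivative chosen by
    [wderiv] is the piecewise derivative, by uniqueness. *)
Lemma piecewise_H1 a m c p1 p2 v : a < m -> m < c -> p1.[m] = p2.[m] ->
  piecewise a m c (horner p1) (horner p2) v ->
  [/\ H1 `]a, c[ v, L2 `]a, c[ (wderiv `]a, c[ v) &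
    {ae mu, forall x, x \in `]a, c[ ->
       wderiv `]a, c[ v x = glue m (horner p1^`()) (horner p2^`()) x}].
Proof.
move=> am mc pm pv; set g := glue _ _ _.
have g2 : L2 `]a, c[ g by exact: glue_L2.
have wg : is_wderiv `]a, c[ v g.
  by move=> phi tphi; rewrite (piecewise_jump am mc pv tphi) pm subrr mul0r sub0r.
have ex : exists g, L2 `]a, c[ g /\ is_wderiv `]a, c[ v g by exists g.
have [l w] := xgetPex (cst 0) ex.
split=> //; first by split=> //; apply: piecewise_L2 pv => //; exact: continuous_horner.
exact: is_wderiv_unique wg.
Qed.

(** Let [G] be the piecewise derivative and [g] a square-integrable weak
    derivative. On either side of [m] the Dirac mass is invisible, so that
    [g = G] almost everywhere; then a bump that is nonzero at [m] detects the
    jump, which must vanish. *)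
Lemma piecewise_H1_continuous a m c p1 p2 v : a < m -> m < c ->
  piecewise a m c (horner p1) (horner p2) v -> H1 `]a, c[ v -> p1.[m] = p2.[m].
Proof.
move=> am mc pv [v2 [g [g2 wg]]].
pose G := glue m (horner p1^`()) (horner p2^`()).
have G2 : L2 `]a, c[ G by exact: glue_L2.
have jump phi : test_function `]a, c[ phi ->
    ip `]a, c[ (g \- G) phi = - ((p1.[m] - p2.[m]) * phi m).
  move=> tphi; have [c0 _] := test_function_continuous tphi.
  rewrite ip_subl//; last exact: L2_continuous.
  by have := wg _ tphi; rewrite (piecewise_jump am mc pv tphi) -/G; lra.
have gG2 := L2B g2 G2.
have sub a' c' : a <= a' -> c' <= c -> ~~ (a' < m < c') ->
    {ae mu, forall x, x \in `]a', c'[ -> (g \- G) x = 0}.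
  move=> aa cc mn; apply: ae0_of_test_integral0.
    exact: integrable_itvS aa cc (L2_integrable gG2).
  move=> phi tphi; have := jump phi (test_functionS aa cc tphi).
  rewrite (test_function_out tphi mn) mulr0 oppr0 => <-.
  rewrite /ip [LHS]Rintegral_mkcond [RHS]Rintegral_mkcond.
  apply: eq_Rintegral => x _; rewrite !patchE !mem_setE !in_itv/=.
  case: ifPn => [/andP[h1 h2]|h]; last first.
    by rewrite (test_function_out tphi h) mulr0; case: ifP.
  by rewrite (le_lt_trans aa h1) (lt_le_trans h2 cc).
have s1 : {ae mu, forall x, x \in `]a, m[ -> (g \- G) x = 0}.
  by apply: sub => //; [exact: ltW|rewrite ltxx andbF].
have s2 : {ae mu, forall x, x \in `]m, c[ -> (g \- G) x = 0}.
  by apply: sub => //; [exact: ltW|rewrite ltxx].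
have am2 : a < (a + m) / 2 by lra.
have mc2 : (m + c) / 2 < c by lra.
have tb := smooth_bump_test 0 am2 mc2.
set phi := smooth_bump _ _ _ in tb.
have := jump phi tb.
have pm : phi m != 0 by rewrite smooth_bump_supp; apply/andP; split; lra.
have [c0 _] := test_function_continuous tb.
have z a' c' : {ae mu, forall x, x \in `]a', c'[ -> (g \- G) x = 0} -> a <= a' -> c' <= c ->
    \int[mu]_(x in `]a', c'[) ((g \- G) x * phi x) = 0.
  move=> h aa cc; rewrite /Rintegral (@ae_eq_integral _ _ _ mu _ (cst 0%E))//.
  - by rewrite integral0.
  - apply/measurable_int/(integrable_itvS aa cc).
    exact: (L2_mul_integrable gG2 (L2_continuous _ _ c0)).
  - move: h; apply: filterS; first exact: (ae_filter_ringOfSetsType mu).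
    by move=> x /= h xK; rewrite h// mul0r.
rewrite /ip (Rintegral_itvU am mc); last exact: (L2_mul_integrable gG2 (L2_continuous _ _ c0)).
rewrite !z// ?ltW// addr0 => /esym/eqP; rewrite oppr_eq0 mulf_eq0 (negbTE pm) orbF subr_eq0.
by move/eqP.
Qed.

End WeakDerivative.

(** * Square linear systems on polynomials of bounded degree *)
Lemma scalar_rVpoly (K : fieldType) (d : nat) (L : {poly K} -> K) (v : 'rV[K]_d) :
  scalar L -> L (rVpoly v) = \sum_i v 0 i * L 'X^i.
Proof.
move=> lL; have L0 : L 0 = 0.
  by apply: (addrI (L 0)); rewrite addr0 -[X in X + _]mul1r -lL scale1r addr0.
rewrite {1}(row_sum_delta v) linear_sum /=.
elim/big_rec2: _ => [//|i y1 y2 _ IH].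
by rewrite linearZ/= rVpoly_delta lL IH.
Qed.

(** In the monomial basis a bilinear form on polynomials of bounded degree is a
    square matrix; if its left kernel is trivial, it represents every linear
    form. *)
Lemma poly_form_surj (K : fieldType) (d : nat) (B : {poly K} -> {poly K} -> K)
    (L : {poly K} -> K) :
  (forall p, scalar (B^~ p)) -> (forall s, scalar (B s)) -> scalar L ->
  (forall s : {poly K}, (size s <= d)%N ->
    (forall p : {poly K}, (size p <= d)%N -> B s p = 0) -> s = 0) ->
  exists2 s : {poly K}, (size s <= d)%N &
    forall p : {poly K}, (size p <= d)%N -> B s p = L p.
Proof.
move=> lB1 lB2 lL B0.
pose A : 'M[K]_d := \matrix_(i, j) B 'X^i 'X^j.
have BA (v w : 'rV_d) : B (rVpoly v) (rVpoly w) = (v *m A *m w^T) 0 0.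
  rewrite (scalar_rVpoly w (lB2 _)) mxE; apply: eq_bigr => j _.
  rewrite (scalar_rVpoly v (lB1 _)) !mxE mulrC; congr (_ * _).
  by apply: eq_bigr => i _; rewrite mxE.
have Au : A \in unitmx.
  rewrite -row_free_unit; apply: inj_row_free => v vA.
  apply: (can_inj rVpolyK); rewrite linear0; apply: B0; first exact: size_poly.
  by move=> p pd; rewrite -(poly_rV_K pd) BA vA mul0mx mxE.
pose v := (\row_j L 'X^j) *m invmx A.
exists (rVpoly v) => [|p pd]; first exact: size_poly.
rewrite -(poly_rV_K pd) BA mulmxKV// (scalar_rVpoly _ lL) mxE.
by apply: eq_bigr => j _; rewrite !mxE mulrC.
Qed.

(** * The problem on one element *)
Section ElementProblem.
Context {R : realType}.
Local Notation mu := (@lebesgue_measure R).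
Implicit Types (a c b : R) (f g u v w : R -> R) (p q s t : {poly R}).

Lemma ip_scalar a c v : L2 `]a, c[ v -> scalar (fun p => ip `]a, c[ v (horner p)).
Proof.
move=> v2 k p q; rewrite /ip -RintegralZl//; last first.
  exact/L2_mul_integrable/L2_continuous/continuous_horner.
rewrite -RintegralD//.
- by apply: eq_Rintegral => x _; rewrite hornerD hornerZ; ring.
- apply: integrable_scale.
  exact/L2_mul_integrable/L2_continuous/continuous_horner.
- exact/L2_mul_integrable/L2_continuous/continuous_horner.
Qed.

Lemma ip_hornerZ a c v k p : L2 `]a, c[ v ->
  ip `]a, c[ v (horner (k *: p)) = k * ip `]a, c[ v (horner p).
Proof.
move=> v2; rewrite /ip -RintegralZl//.
  by apply: eq_Rintegral => x _; rewrite hornerZ mulrCA.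
exact/L2_mul_integrable/L2_continuous/continuous_horner.
Qed.

(** Otherwise the interval would be the union of a null set and of the finite set
    of roots of [p]. *)
Lemma poly_eq0_of_ae a c p : a < c ->
  {ae mu, forall x, x \in `]a, c[ -> p.[x] = 0} -> p = 0.
Proof.
move=> ac [N [mN N0 sN]]; apply: contrapT => /eqP pn0.
have fin : finite_set [set x | root p x].
  apply: contrapT => /(@infinite_set_fset _ _ (size p)) [S Sr].
  rewrite leqNgt => /negP; apply.
  apply: (max_poly_roots pn0); last exact: fset_uniq.
  by apply/allP => x xS; exact: Sr.
have neg : mu.-negligible `]a, c[%classic.
  apply: (@negligibleS _ _ _ mu (N `|` [set x | root p x])).
    move=> x xac; have [rx|rx] := boolP (root p x); first by right.
    by left; apply: sN => /(_ xac) /eqP; rewrite -/(root p x) (negbTE rx).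
  apply: negligibleU; first exact/negligibleP.
  apply/negligibleP; first by apply: countable_measurable => //; exact: finite_set_countable.
  exact/countable_lebesgue_measure0/finite_set_countable.
have : mu `]a, c[%classic = 0%E by exact: measure_negligible neg.
rewrite lebesgue_measure_itv/= lte_fin ac.
by rewrite -EFinB => -[] /eqP; rewrite subr_eq0 gt_eqF.
Qed.

(** By Cauchy-Schwarz [p] is orthogonal to all test functions. *)
Lemma poly_nrm0 a c p : a < c -> ip `]a, c[ (horner p) (horner p) = 0 -> p = 0.
Proof.
move=> ac p0; apply: (poly_eq0_of_ae ac); apply: ae0_of_test_integral0.
  exact: L2_integrable (horner_L2 _ _ _).
move=> phi tphi; apply/eqP; rewrite -normr_le0.
have [c0 _] := test_function_continuous tphi.
apply: le_trans (cauchy_schwarz (horner_L2 a c p) (L2_continuous a c c0)) _.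
by rewrite {1}/nrm p0 sqrtr0 mul0r.
Qed.

(** The restriction of a hat function to an element [`]a, c[] of its support:
    increasing when the vertex is the right end point, decreasing when it is the
    left one. *)
Definition hat_piece (up : bool) a c : {poly R} :=
  (c - a)^-1 *: (if up then 'X - a%:P else c%:P - 'X).

Definition orient (up : bool) : R := if up then 1 else -1.

Lemma hat_piece_deriv up a c : (hat_piece up a c)^`() = (orient up / (c - a))%:P.
Proof.
rewrite /hat_piece derivZ; case: up; rewrite derivB derivX derivC ?subr0 ?sub0r.
  by rewrite -mul_polyC mulr1 mul1r.
by rewrite -mul_polyC mulrN1 -polyCN mulN1r.
Qed.

Lemma hat_piece_end up a c : a < c ->
  (hat_piece up a c).[a] = (~~ up)%:R /\ (hat_piece up a c).[c] = up%:R.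
Proof.
move=> ac; have ca : c - a != 0 by lra.
by case: up; rewrite /hat_piece !hornerE/=; split; field.
Qed.

Lemma hat_piece_ge0_le1 up a c x : a < x < c -> 0 <= (hat_piece up a c).[x] <= 1.
Proof.
move=> /andP[ax xc]; have ca : 0 < c - a by lra.
rewrite /hat_piece; case: up; rewrite !hornerE/= mulrC.
  by rewrite ler_pdivrMr// divr_ge0; lra.
by rewrite ler_pdivrMr// divr_ge0; lra.
Qed.

Lemma Rintegral_deriv_poly a c p : a < c ->
  \int[mu]_(x in `]a, c[) p^`().[x] = p.[c] - p.[a].
Proof.
by move=> ac; apply: Rintegral_derive => // x; exact: continuous_horner.
Qed.

Definition elt_form up a c b s p : R :=
  ip `]a, c[ (horner (b *: (hat_piece up a c * s)^`())) (horner p).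

(** The integral of [(f psi + b psi' u) p], arranged so that only products of two
    square-integrable functions occur. *)
Definition elt_load up a c b f u p : R :=
  ip `]a, c[ f (horner (hat_piece up a c * p)) +
  ip `]a, c[ u (horner ((b *: (hat_piece up a c)^`()) * p)).

Definition hat_vertex (up : bool) a c : R := if up then c else a.

(** Energy identity. It is the integral of
    [(psi s^2)' = 2 (psi s)' s - psi' s^2], where [psi'] is the constant
    [orient up / (c - a)] and [psi] vanishes at the end opposite to the
    vertex. *)
Lemma elt_form_self up a c b s : a < c ->
  2 * orient up * elt_form up a c b s s =
  b * (ip `]a, c[ (horner s) (horner s) / (c - a) + s.[hat_vertex up a c] ^+ 2).
Proof.
move=> ac; have ca : c - a != 0 by lra.
set h := hat_piece up a c.
have [ha hc] := hat_piece_end up ac.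
have cont p : mu.-integrable `]a, c[ (EFin \o horner p).
  exact/L2_integrable/horner_L2.
have := Rintegral_deriv_poly (h * (s * s)) ac.
rewrite (@eq_Rintegral _ _ _ mu _ (fun x => 2 * (((h * s)^`() * s).[x]) -
   orient up / (c - a) * (s * s).[x])).
  rewrite RintegralB// ?RintegralZl//; last 2 first.
  - exact: integrable_scale.
  - exact: integrable_scale.
  have -> : \int[mu]_(x in `]a, c[) (s * s).[x] = ip `]a, c[ (horner s) (horner s).
    by apply: eq_Rintegral => x _; rewrite hornerM.
  have -> : elt_form up a c b s s = b * \int[mu]_(x in `]a, c[) ((h * s)^`() * s).[x].
    rewrite -RintegralZl//; apply: eq_Rintegral => x _.
    by rewrite hornerZ hornerM mulrA.
  rewrite !(hornerM h) !hornerM ha hc => /(congr1 (fun z => b * orient up * z)).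
  by rewrite /orient /hat_vertex; case: up @h {ha hc} => /=; lra.
move=> x _; rewrite !derivM hat_piece_deriv !(hornerD, hornerM, hornerC); ring.
Qed.

(** Both terms on the right of [elt_form_self] are nonnegative: whatever the sign
    of [b], the form controls the norm of [s]. This gives injectivity, hence
    existence and uniqueness on the element, and stability. *)
Lemma elt_form_coercive up a c b s : a < c -> b != 0 ->
  ip `]a, c[ (horner s) (horner s) <=
  2 * (c - a) / `|b| * `|elt_form up a c b s s|.
Proof.
move=> ac b0; have ca : 0 < c - a by lra.
have bp : 0 < `|b| by rewrite normr_gt0.
have := congr1 Num.norm (elt_form_self up b s ac).
set N := ip _ _ _; set V := s.[_] ^+ 2; set F := elt_form _ _ _ _ _ _.
have N0 : 0 <= N by exact: ip_ge0.
have V0 : 0 <= V by exact: sqr_ge0.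
have o1 : `|orient up| = 1 by rewrite /orient; case: ifP; rewrite ?normrN normr1.
rewrite !normrM o1 mulr1 ger0_norm// (ger0_norm (x := _ + _)); last first.
  by rewrite addr_ge0// divr_ge0// ltW.
move=> E; have -> : 2 * (c - a) / `|b| * `|F| = (c - a) / `|b| * (2 * `|F|) by ring.
rewrite E; have -> : (c - a) / `|b| * (`|b| * (N / (c - a) + V)) = N + (c - a) * V.
  by field; rewrite !gt_eqF.
by rewrite lerDl mulr_ge0// ltW.
Qed.

Lemma elt_form_scalar_l up a c b p : scalar (fun s => elt_form up a c b s p).
Proof.
move=> k s t; rewrite /elt_form ![ip _ _ (horner p)]ipC -ip_scalar; last exact: horner_L2.
congr (ip _ _ (horner _)).
by rewrite mulrDr -scalerAr derivD derivZ scalerDr !scalerA mulrC.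
Qed.

Lemma elt_load_scalar up a c b f u : L2 `]a, c[ f -> L2 `]a, c[ u ->
  scalar (elt_load up a c b f u).
Proof.
move=> f2 u2 k p q; rewrite /elt_load !mulrDr -!scalerAr !ip_scalar//; ring.
Qed.

Lemma elt_exists up a c b f u k : a < c -> b != 0 -> L2 `]a, c[ f -> L2 `]a, c[ u ->
  exists2 s : {poly R}, (size s <= k)%N &
    forall p : {poly R}, (size p <= k)%N ->
      elt_form up a c b s p = elt_load up a c b f u p.
Proof.
move=> ac b0 f2 u2; apply: poly_form_surj.
- by move=> p; exact: elt_form_scalar_l.
- by move=> s; apply: ip_scalar; exact: horner_L2.
- exact: elt_load_scalar.
- move=> s sk /(_ s sk) s0; apply: (poly_nrm0 ac); apply: le_anti; rewrite ip_ge0 andbT.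
  by have := elt_form_coercive up s ac b0; rewrite s0 normr0 mulr0.
Qed.

Lemma elt_unique up a c b s t k : a < c -> b != 0 -> (size s <= k)%N -> (size t <= k)%N ->
  (forall p : {poly R}, (size p <= k)%N -> elt_form up a c b s p = elt_form up a c b t p) ->
  s = t.
Proof.
move=> ac b0 sk tk st; apply/eqP; rewrite -subr_eq0; apply/eqP.
have d0 : elt_form up a c b (s - t) (s - t) = 0.
  rewrite -[s - t]addrC -scaleN1r elt_form_scalar_l mulN1r addrC st ?subrr//.
  by rewrite (leq_trans (size_polyD _ _))// geq_max size_scale ?oppr_eq0 ?oner_eq0// tk sk.
apply: (poly_nrm0 ac); apply: le_anti; rewrite ip_ge0 andbT.
by have := elt_form_coercive up (s - t) ac b0; rewrite d0 normr0 mulr0.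
Qed.

Lemma nrm_hat_mul up a c s : nrm `]a, c[ (horner (hat_piece up a c * s)) <= nrm `]a, c[ (horner s).
Proof.
rewrite ler_wsqrtr// /ip; apply: le_Rintegral => //; try exact: (L2_mul_integrable (horner_L2 _ _ _) (horner_L2 _ _ _)).
move=> x; rewrite /= in_itv/= => /hat_piece_ge0_le1 => /(_ up)/andP[h0 h1].
rewrite hornerM mulrACA ler_piMl ?mulr_ile1//.
by rewrite -expr2 sqr_ge0.
Qed.

(** Test with [s] itself: the load is at most
    [(nrm f + |b| / (c - a) * nrm u) * nrm s], because [psi <= 1] and
    [|psi'| = 1 / (c - a)]. *)
Lemma elt_stable up a c b f u s : a < c -> b != 0 -> L2 `]a, c[ f -> L2 `]a, c[ u ->
  elt_form up a c b s s = elt_load up a c b f u s ->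
  nrm `]a, c[ (horner s) <= 2 * (c - a) / `|b| * nrm `]a, c[ f + 2 * nrm `]a, c[ u.
Proof.
move=> ac b0 f2 u2 fs; have ca : 0 < c - a by lra.
have bp : 0 < `|b| by rewrite normr_gt0.
have := elt_form_coercive up s ac b0; rewrite fs -nrm_sqr.
set S := nrm _ (horner s).
have S0 : 0 <= S by exact: sqrtr_ge0.
have f0 : 0 <= nrm `]a, c[ f by exact: sqrtr_ge0.
have u0 : 0 <= nrm `]a, c[ u by exact: sqrtr_ge0.
have L : `|elt_load up a c b f u s| <= nrm `]a, c[ f * S + `|b| / (c - a) * nrm `]a, c[ u * S.
  rewrite (le_trans (ler_normD _ _))// lerD//.
    apply: (le_trans (cauchy_schwarz f2 (horner_L2 _ _ _))).
    by rewrite ler_wpM2l// nrm_hat_mul.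
  rewrite hat_piece_deriv -mul_polyC -polyCM mul_polyC ip_hornerZ// normrM.
  have -> : `|b * (orient up / (c - a))| = `|b| / (c - a).
    rewrite !normrM normfV (gtr0_norm ca) /orient.
    by case: ifP; rewrite ?normrN normr1 mul1r.
  rewrite -[leRHS]mulrA ler_wpM2l ?(divr_ge0 (ltW bp) (ltW ca))//.
  exact: (cauchy_schwarz u2 (horner_L2 _ _ _)).
have [S00|Sn0] := eqVneq S 0.
  by rewrite S00 => _; rewrite addr_ge0// !mulr_ge0// ?invr_ge0// ltW.
have Sp : 0 < S by rewrite lt_neqAle eq_sym Sn0.
move=> H; rewrite -(ler_pM2r Sp) -expr2 (le_trans H)//.
have k0 : 0 <= 2 * (c - a) / `|b| by rewrite !mulr_ge0// ?invr_ge0// ltW.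
rewrite (le_trans (ler_wpM2l k0 L))// le_eqVlt; apply/orP; left; apply/eqP.
by field; rewrite !gt_eqF.
Qed.

(** Testing with 1 integrates an exact derivative: the vertex value of [s] can be
    read off from the load of the constant 1. *)
Lemma elt_endpoint up a c b s : a < c ->
  elt_form up a c b s 1 = b * orient up * s.[hat_vertex up a c].
Proof.
move=> ac; have [ha hc] := hat_piece_end up ac.
have -> : elt_form up a c b s 1 = \int[mu]_(x in `]a, c[) (b *: (hat_piece up a c * s))^`().[x].
  by apply: eq_Rintegral => x _; rewrite hornerC mulr1 derivZ.
rewrite Rintegral_deriv_poly// !hornerZ !hornerM ha hc /orient /hat_vertex.
by case: up {ha hc} => /=; ring.
Qed.

End ElementProblem.

(** * From a patch to its elements *)
Section Patch.
Context {R : realType}.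
Local Notation mu := (@lebesgue_measure R).
Implicit Types (a m c b : R) (f g u v w psi sh : R -> R) (p q s h : {poly R}).

Lemma piecewiseM a m c h1 h2 p1 p2 psi v :
  piecewise a m c (horner h1) (horner h2) psi ->
  piecewise a m c (horner p1) (horner p2) v ->
  piecewise a m c (horner (h1 * p1)) (horner (h2 * p2)) (psi \* v).
Proof.
move=> [e1 e2] [e3 e4]; split=> x xK; rewrite /= hornerM.
  by rewrite e1// e3.
by rewrite e2// e4.
Qed.

Lemma piecewiseZ a m c b p1 p2 v :
  piecewise a m c (horner p1) (horner p2) v ->
  piecewise a m c (horner (b *: p1)) (horner (b *: p2)) (fun x => b * v x).
Proof. by move=> [e1 e2]; split=> x xK; rewrite hornerZ; [rewrite e1|rewrite e2]. Qed.

(** The chosen weak derivative is replaced by the piecewise one, after which the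
    left-hand side of the patch equation splits into element contributions; the
    next lemma does the same for the right-hand side. *)
Lemma ip_wderiv_piecewise a m c b p1 p2 q1 q2 w v : a < m -> m < c ->
  piecewise a m c (horner p1) (horner p2) w -> p1.[m] = p2.[m] ->
  piecewise a m c (horner q1) (horner q2) v ->
  ip `]a, c[ (fun x => b * wderiv `]a, c[ w x) v =
  ip `]a, m[ (horner (b *: p1^`())) (horner q1) +
  ip `]m, c[ (horner (b *: p2^`())) (horner q2).
Proof.
move=> am mc pw pm pv; have [_ l wG] := piecewise_H1 am mc pm pw.
have v2 := piecewise_L2 am mc (continuous_horner (p:=q1)) (continuous_horner (p:=q2)) pv.
have pG := piecewiseZ b (glueP a m c (horner p1^`()) (horner p2^`())).
rewrite (@ip_ae _ _ _ _ (fun x => b * glue m (horner p1^`()) (horner p2^`()) x)).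
- rewrite (ip_piecewise am mc (continuous_horner (p:=q1)) (continuous_horner (p:=q2)) _ pv).
    by case: pG => g1 g2; congr (_ + _); apply: eq_Rintegral => x; rewrite inE => xK;
      rewrite ?(g1 x xK) ?(g2 x xK).
  by apply: piecewise_L2 pG => //; exact: continuous_horner.
- by apply: measurable_funM => //; exact: L2_measurable.
- by apply: measurable_funM => //; apply: L2_measurable; exact: glue_L2.
- exact: L2_measurable.
- move: wG; apply: filterS; first exact: (ae_filter_ringOfSetsType mu).
  by move=> x h xK; rewrite h.
Qed.

Lemma ip_load_piecewise a m c b h1 h2 p1 p2 psi f u v : a < m -> m < c ->
  L2 `]a, c[ f -> L2 `]a, c[ u ->
  piecewise a m c (horner h1) (horner h2) psi -> h1.[m] = h2.[m] ->
  piecewise a m c (horner p1) (horner p2) v ->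
  ip `]a, c[ (fun x => f x * psi x + b * wderiv `]a, c[ psi x * u x) v =
  (ip `]a, m[ f (horner (h1 * p1)) + ip `]a, m[ u (horner ((b *: h1^`()) * p1))) +
  (ip `]m, c[ f (horner (h2 * p2)) + ip `]m, c[ u (horner ((b *: h2^`()) * p2))).
Proof.
move=> am mc f2 u2 ppsi hm pv; have [_ l wG] := piecewise_H1 am mc hm ppsi.
have cp p := @continuous_horner R p.
set G := glue _ _ _ in wG.
have v2 := piecewise_L2 am mc (cp _) (cp _) pv.
have psi2 := piecewise_L2 am mc (cp _) (cp _) ppsi.
have G2 : L2 `]a, c[ G by exact: glue_L2.
have pG := piecewiseM (piecewiseZ b (glueP a m c (horner h1^`()) (horner h2^`()))) pv.
have pp := piecewiseM ppsi pv.
rewrite (@ip_ae _ _ _ _ (fun x => f x * psi x + b * G x * u x)); first last.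
- move: wG; apply: filterS; first exact: (ae_filter_ringOfSetsType mu).
  by move=> x h xK; rewrite h.
- exact: L2_measurable.
- by apply: measurable_funD; apply: measurable_funM; rewrite ?measurable_funM//; try exact: L2_measurable;
   apply: measurable_funM => //; exact: L2_measurable.
- by apply: measurable_funD; apply: measurable_funM; rewrite ?measurable_funM//; try exact: L2_measurable;
   apply: measurable_funM => //; exact: L2_measurable.
have -> : ip `]a, c[ (fun x => f x * psi x + b * G x * u x) v =
    ip `]a, c[ f (psi \* v) + ip `]a, c[ u ((fun x => b * G x) \* v).
  rewrite /ip -RintegralD//.
  - by apply: eq_Rintegral => x _ /=; ring.
  - exact/L2_mul_integrable/(piecewise_L2 am mc (cp _) (cp _) pp).
  - exact/L2_mul_integrable/(piecewise_L2 am mc (cp _) (cp _) pG).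
rewrite (ip_piecewise am mc (cp _) (cp _) f2 pp).
rewrite (ip_piecewise am mc (cp _) (cp _) u2 pG).
by rewrite addrACA.
Qed.

End Patch.

(** * Well-posedness on a patch *)
Section PatchProblem.
Context {R : realType}.
Local Notation mu := (@lebesgue_measure R).
Implicit Types (a m c b : R) (f g u v w psi sh : R -> R) (p q s h : {poly R}).

(** The local problem for an arbitrary broken space and hat function, which
    covers the patches of two elements and those of a single one. *)
Definition patch_solution (D : set R) (broken : (R -> R) -> Prop) b psi f u sh :=
  (broken sh /\ H1 D sh) /\
  forall v, broken v ->
    ip D (fun x => b * wderiv D (psi \* sh) x) v =
    ip D (fun x => f x * psi x + b * wderiv D psi x * u x) v.

(** The bound [k] is on sizes, that is, on degrees plus one. *)
Definition broken1 k a c v :=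
  exists2 p : {poly R}, (size p <= k)%N & {in `]a, c[, v =1 horner p}.

Definition broken2 k a m c v :=
  exists p1 p2 : {poly R}, [/\ (size p1 <= k)%N, (size p2 <= k)%N &
    piecewise a m c (horner p1) (horner p2) v].

Lemma ip_horner0 (D : set R) v : ip D v (horner 0) = 0.
Proof.
rewrite /ip (@eq_Rintegral _ _ _ mu D (cst 0)); last by move=> x _; rewrite horner0 mulr0.
by rewrite /Rintegral integral0_eq.
Qed.

Lemma elt_form0 up a c b s : elt_form up a c b s 0 = 0.
Proof. exact: ip_horner0. Qed.

Lemma elt_load0 up a c b f u : elt_load up a c b f u 0 = 0.
Proof. by rewrite /elt_load !mulr0 !ip_horner0 addr0. Qed.

Lemma ip_piecewise_self a m c p1 p2 v : a < m -> m < c ->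
  piecewise a m c (horner p1) (horner p2) v ->
  ip `]a, c[ v v = ip `]a, m[ (horner p1) (horner p1) + ip `]m, c[ (horner p2) (horner p2).
Proof.
move=> am mc pv; have cp p := @continuous_horner R p.
rewrite (ip_piecewise am mc (cp _) (cp _) (piecewise_L2 am mc (cp _) (cp _) pv) pv).
by case: pv => v1 v2; congr (_ + _); apply: eq_Rintegral => x; rewrite inE => xK;
  rewrite ?(v1 x xK) ?(v2 x xK).
Qed.

Lemma ip_selfU a m c v : a < m -> m < c -> L2 `]a, c[ v ->
  ip `]a, c[ v v = ip `]a, m[ v v + ip `]m, c[ v v.
Proof. by move=> am mc v2; apply: Rintegral_itvU => //; exact: L2_mul_integrable. Qed.

Lemma ae_except_point (P : R -> Prop) m : (forall x, x != m -> P x) -> {ae mu, forall x, P x}.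
Proof.
move=> Pm; exists [set m]; split=> //; first exact: lebesgue_measure_set1.
by move=> x nP; apply: contrapT => /eqP /Pm.
Qed.

(** Testing with functions supported in one element decouples the problem into
    two element problems, whose solutions are glued. The orthogonality of the
    residual to the hat function is exactly the continuity of the glued function
    at the common vertex; conversely any solution is continuous there, so its
    pieces solve the element problems and are unique. In the bound, each element
    contributes [2 h / |b| * nrm f + 2 * nrm u]. *)
Lemma patch2_wellposed a m c b k f u psi : a < m -> m < c -> b != 0 -> (0 < k)%N ->
  L2 `]a, c[ f -> L2 `]a, c[ u ->
  piecewise a m c (horner (hat_piece true a m)) (horner (hat_piece false m c)) psi ->
  ip `]a, c[ f psi + ip `]a, c[ u (fun x => b * wderiv `]a, c[ psi x) = 0 ->
  exists sh,
    [/\ patch_solution `]a, c[ (broken2 k a m c) b psi f u sh,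
      (forall t, patch_solution `]a, c[ (broken2 k a m c) b psi f u t ->
         {ae mu, forall x, x \in `]a, c[ -> t x = sh x})
    & nrm `]a, c[ sh <=
      (4 / `|b| + 4) * ((c - a) * nrm `]a, c[ f + nrm `]a, c[ u)].
Proof.
move=> am mc b0 k0 f2 u2 ppsi compat; have cp p := @continuous_horner R p.
set h1 := hat_piece true a m; set h2 := hat_piece false m c.
have hm1 : h1.[m] = 1 by case: (hat_piece_end true am).
have hm2 : h2.[m] = 1 by case: (hat_piece_end false mc).
have hm : h1.[m] = h2.[m] by rewrite hm1 hm2.
have fl : L2 `]a, m[ f by apply: L2S f2 => //; exact: ltW.
have fr : L2 `]m, c[ f by apply: L2S f2 => //; exact: ltW.
have ul : L2 `]a, m[ u by apply: L2S u2 => //; exact: ltW.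
have ur : L2 `]m, c[ u by apply: L2S u2 => //; exact: ltW.
have lhsE s1 s2 t p1 p2 v : piecewise a m c (horner s1) (horner s2) t -> s1.[m] = s2.[m] ->
    piecewise a m c (horner p1) (horner p2) v ->
    ip `]a, c[ (fun x => b * wderiv `]a, c[ (psi \* t) x) v =
    elt_form true a m b s1 p1 + elt_form false m c b s2 p2.
  move=> pt st pv; rewrite (ip_wderiv_piecewise b am mc (piecewiseM ppsi pt) _ pv)//.
  by rewrite !hornerM hm st.
have rhsE p1 p2 v : piecewise a m c (horner p1) (horner p2) v ->
    ip `]a, c[ (fun x => f x * psi x + b * wderiv `]a, c[ psi x * u x) v =
    elt_load true a m b f u p1 + elt_load false m c b f u p2.
  by move=> pv; exact: (ip_load_piecewise b am mc f2 u2 ppsi hm pv).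
have [s1 sk1 sE1] := @elt_exists R true a m b f u k am b0 fl ul.
have [s2 sk2 sE2] := @elt_exists R false m c b f u k mc b0 fr ur.
(* the loads of the constant 1 on both elements are b * s1.[m] and - b * s2.[m];
   the orthogonality relation says that they cancel *)
have sm : s1.[m] = s2.[m].
  have k1 : (size (1%R : {poly R}) <= k)%N by rewrite size_poly1.
  have /= e1 := elt_endpoint true b s1 am; have /= e2 := elt_endpoint false b s2 mc.
  have l0 : elt_load true a m b f u 1 + elt_load false m c b f u 1 = 0.
    have p1 : piecewise a m c (horner 1) (horner 1) (cst 1).
      by split=> x _; rewrite hornerC.
    rewrite -(rhsE _ _ _ p1) -compat /ip -RintegralD//.
    - by apply: eq_Rintegral => x _ /=; ring.
    - exact/L2_mul_integrable/(piecewise_L2 am mc (cp _) (cp _) ppsi).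
    - have [_ l _] := piecewise_H1 am mc hm ppsi.
      have := integrable_scale b (L2_mul_integrable u2 l).
      by apply: eq_integrable => // x _ /=; rewrite mulrCA.
  move: l0; rewrite -sE1// -sE2// e1 e2 => /eqP.
  rewrite mulr1 mulrN1 mulNr subr_eq0 => /eqP; exact: mulfI.
pose sh := glue m (horner s1) (horner s2).
have psh : piecewise a m c (horner s1) (horner s2) sh by exact: glueP.
exists sh; split.
- split.
    split; first by exists s1, s2.
    by have [] := piecewise_H1 am mc sm psh.
  move=> v [p1 [p2 [pk1 pk2 pv]]].
  by rewrite (lhsE _ _ _ _ _ _ psh sm pv) (rhsE _ _ _ pv) sE1// sE2.
- move=> t [[[t1 [t2 [tk1 tk2 pt]]] tH] tE].
  have tm := piecewise_H1_continuous am mc pt tH.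
  have tE2 (p1 p2 : {poly R}) : (size p1 <= k)%N -> (size p2 <= k)%N ->
      elt_form true a m b t1 p1 + elt_form false m c b t2 p2 =
      elt_load true a m b f u p1 + elt_load false m c b f u p2.
    move=> pk1 pk2; have pv := glueP a m c (horner p1) (horner p2).
    rewrite -(lhsE _ _ _ _ _ _ pt tm pv) -(rhsE _ _ _ pv); apply: tE.
    by exists p1, p2.
  have k0' : (size (0%R : {poly R}) <= k)%N by rewrite size_poly0.
  have t1s : t1 = s1.
    apply: (elt_unique (up := true) am b0 tk1 sk1) => p pk; rewrite sE1//.
    by have := tE2 p 0 pk k0'; rewrite elt_form0 elt_load0 !addr0.
  have t2s : t2 = s2.
    apply: (elt_unique (up := false) mc b0 tk2 sk2) => p pk; rewrite sE2//.
    by have := tE2 0 p k0' pk; rewrite elt_form0 elt_load0 !add0r.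
  rewrite t1s t2s in pt; apply: (@ae_except_point _ m) => x xm xac.
  case: pt psh => [t1E t2E] [s1E s2E].
  move: xac xm; rewrite in_itv/= => /andP[ax xc]; rewrite neq_lt => /orP[xm|xm].
    by rewrite t1E ?s1E// in_itv/= ax.
  by rewrite t2E ?s2E// in_itv/= xm.
- have n1 := elt_stable am b0 fl ul (sE1 _ sk1).
  have n2 := elt_stable mc b0 fr ur (sE2 _ sk2).
  have S2 : nrm `]a, c[ sh ^+ 2 = nrm `]a, m[ (horner s1) ^+ 2 + nrm `]m, c[ (horner s2) ^+ 2.
    by rewrite !nrm_sqr; exact: ip_piecewise_self.
  have F v : L2 `]a, c[ v -> nrm `]a, m[ v <= nrm `]a, c[ v /\ nrm `]m, c[ v <= nrm `]a, c[ v.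
    by move=> v2; split; rewrite ler_wsqrtr// (ip_selfU am mc v2) ?lerDl ?lerDr ip_ge0.
  have [f1 f3] := F _ f2; have [u1 u3] := F _ u2.
  have N0 (D : set R) v : 0 <= nrm D v by exact: sqrtr_ge0.
  have SS : nrm `]a, c[ sh <= nrm `]a, m[ (horner s1) + nrm `]m, c[ (horner s2).
    rewrite -(ler_pXn2r (n := 2))// ?nnegrE ?addr_ge0// S2 sqrrD.
    by rewrite lerD2r lerDl mulrn_wge0// mulr_ge0.
  have iB : 0 <= `|b|^-1 by rewrite invr_ge0.
  apply: (le_trans SS); apply: (le_trans (lerD n1 n2)).
  have g1 : (m - a) * `|b|^-1 * nrm `]a, m[ f <= (c - a) * `|b|^-1 * nrm `]a, c[ f.
    apply: ler_pM => //; first by rewrite mulr_ge0// subr_ge0 ltW.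
    by rewrite ler_wpM2r//; lra.
  have g2 : (c - m) * `|b|^-1 * nrm `]m, c[ f <= (c - a) * `|b|^-1 * nrm `]a, c[ f.
    apply: ler_pM => //; first by rewrite mulr_ge0// subr_ge0 ltW.
    by rewrite ler_wpM2r//; lra.
  have g3 : 0 <= (c - a) * nrm `]a, c[ f by rewrite mulr_ge0// subr_ge0 ltW// (lt_trans am).
  have g4 : 0 <= `|b|^-1 * nrm `]a, c[ u by rewrite mulr_ge0.
  lra.
Qed.

(** Splitting the element artificially at its midpoint reduces the weak
    derivatives to the case of two equal pieces. *)
Lemma patch1_wellposed up a c b k f u psi : a < c -> b != 0 ->
  L2 `]a, c[ f -> L2 `]a, c[ u ->
  {in `]a, c[, psi =1 horner (hat_piece up a c)} ->
  exists sh,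
    [/\ patch_solution `]a, c[ (broken1 k a c) b psi f u sh,
      (forall t, patch_solution `]a, c[ (broken1 k a c) b psi f u t ->
         {ae mu, forall x, x \in `]a, c[ -> t x = sh x})
    & nrm `]a, c[ sh <=
      (4 / `|b| + 4) * ((c - a) * nrm `]a, c[ f + nrm `]a, c[ u)].
Proof.
move=> ac b0 f2 u2 psiE; have cp p := @continuous_horner R p.
pose m := (a + c) / 2.
have am : a < m by rewrite /m; lra.
have mc : m < c by rewrite /m; lra.
set h := hat_piece up a c.
have pw1 v p : {in `]a, c[, v =1 horner p} -> piecewise a m c (horner p) (horner p) v.
  move=> vE; split=> x; rewrite in_itv/= => /andP[x1 x2]; apply: vE; rewrite in_itv/=.
    by rewrite x1 (lt_trans x2).
  by rewrite (lt_trans am).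
have ppsi := pw1 _ _ psiE.
have splitE w p : L2 `]a, c[ w -> ip `]a, c[ w (horner p) =
    ip `]a, m[ w (horner p) + ip `]m, c[ w (horner p).
  by move=> w2; apply: (ip_piecewise am mc (cp _) (cp _) w2); exact: pw1.
have lhsE s t p v : {in `]a, c[, t =1 horner s} -> {in `]a, c[, v =1 horner p} ->
    ip `]a, c[ (fun x => b * wderiv `]a, c[ (psi \* t) x) v = elt_form up a c b s p.
  move=> /pw1 pt /pw1 pv; rewrite (ip_wderiv_piecewise b am mc (piecewiseM ppsi pt) _ pv)//.
  by rewrite -splitE; [rewrite /elt_form|exact: horner_L2].
have rhsE p v : {in `]a, c[, v =1 horner p} ->
    ip `]a, c[ (fun x => f x * psi x + b * wderiv `]a, c[ psi x * u x) v =
    elt_load up a c b f u p.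
  move=> /pw1 pv; rewrite (ip_load_piecewise b am mc f2 u2 ppsi _ pv)//.
  by rewrite addrACA -!splitE.
have [s sk sE] := @elt_exists R up a c b f u k ac b0 f2 u2.
have pss : {in `]a, c[, horner s =1 horner s} by [].
exists (horner s); split.
- split.
    split; first by exists s.
    by have [] := piecewise_H1 am mc erefl (pw1 _ _ pss).
  by move=> v [p pk pv]; rewrite (lhsE _ _ _ _ pss pv) (rhsE _ _ pv) sE.
- move=> t [[[t1 tk pt] tH] tE]; apply/aeW => x xac; rewrite pt//.
  suff -> : t1 = s by [].
  apply: (elt_unique (up := up) ac b0 tk sk) => p pk; rewrite sE//.
  have pp : {in `]a, c[, horner p =1 horner p} by [].
  by rewrite -(lhsE _ _ _ _ pt pp) -(rhsE _ _ pp); apply: tE; exists p.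
- apply: (le_trans (elt_stable ac b0 f2 u2 (sE _ sk))).
  have N0 (D : set R) v : 0 <= nrm D v by exact: sqrtr_ge0.
  have iB : 0 <= `|b|^-1 by rewrite invr_ge0.
  have g1 : 0 <= (c - a) * nrm `]a, c[ f by rewrite mulr_ge0// subr_ge0 ltW.
  have g2 : 0 <= `|b|^-1 * ((c - a) * nrm `]a, c[ f) by rewrite mulr_ge0.
  have g4 : 0 <= `|b|^-1 * nrm `]a, c[ u by rewrite mulr_ge0.
  have g5 := N0 `]a, c[%classic u.
  lra.
Qed.

End PatchProblem.

(** * Patches of a mesh *)
Section MeshPatch.
Context {R : realType}.
Context (l r : R) (s : seq R) (lr : l < r) (ls : itv_partition l r s).
Implicit Types (v : R -> R) (p : {poly R}).

Lemma mesh_size_gt0 : (0 < size s)%N.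
Proof.
rewrite lt0n; apply/negP => /eqP/size0nil s0; move: ls; rewrite s0.
by move=> /itv_partition_nil lr0; move: lr; rewrite lr0 ltxx.
Qed.

Lemma vtx_size : vtx l r s (size s) = r.
Proof. by have [_ /eqP <-] := ls; rewrite /vtx nth_last. Qed.

Lemma vtx_sizeS : vtx l r s (size s).+1 = r.
Proof. by rewrite /vtx nth_default. Qed.

Lemma hat_left i : (0 < i)%N ->
  {in `]vtx l r s i.-1, vtx l r s i[, hat l r s i =1 horner (hat_piece true (vtx l r s i.-1) (vtx l r s i))}.
Proof.
move=> i0 y; rewrite in_itv/= => /andP[y1 y2].
by rewrite /hat i0 (ltW y1) (ltW y2) /= /hat_piece !hornerE/= mulrC.
Qed.

Lemma hat_right i : (i < size s)%N ->
  {in `]vtx l r s i, vtx l r s i.+1[, hat l r s i =1 horner (hat_piece false (vtx l r s i) (vtx l r s i.+1))}.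
Proof.
move=> iN y; rewrite in_itv/= => /andP[y1 y2].
rewrite /hat iN (ltW y1) (ltW y2) [y <= vtx _ _ _ i]leNgt y1 !andbF /=.
by rewrite /hat_piece !hornerE/= mulrC.
Qed.

Lemma broken_poly_interior k i : (0 < i < size s)%N ->
  broken_poly l r s k i = broken2 k.+1 (vtx l r s i.-1) (vtx l r s i) (vtx l r s i.+1).
Proof.
move=> /andP[i0 iN]; have iN' : (i.-1 < size s)%N by exact: leq_ltn_trans (leq_pred _) iN.
apply/funext => v; apply/propext; split.
  move=> bv.
  have [|p1 s1 e1] := bv i.-1; first by rewrite /patch_elt iN' prednK// eqxx orbT.
  have [|p2 s2 e2] := bv i; first by rewrite /patch_elt iN eqxx.
  rewrite /elt prednK// in e1.
  by exists p1, p2; split=> //; split.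
move=> [p1 [p2 [s1 s2 [e1 e2]]]] j /andP[jN /orP[/eqP ->|/eqP ji]].
  by exists p2.
exists p1 => // y; rewrite /elt ji; have -> : j = i.-1 by rewrite -ji.
exact: e1.
Qed.

Lemma broken_poly_first k :
  broken_poly l r s k 0 = broken1 k.+1 (vtx l r s 0) (vtx l r s 1).
Proof.
apply/funext => v; apply/propext; split.
  move=> bv; have [|p s1 e1] := bv 0%N; first by rewrite /patch_elt mesh_size_gt0.
  by exists p.
by move=> [p sp e] j /andP[_ /orP[/eqP ->|//]]; exists p.
Qed.

Lemma broken_poly_last k :
  broken_poly l r s k (size s) = broken1 k.+1 (vtx l r s (size s).-1) (vtx l r s (size s)).
Proof.
have N0 := mesh_size_gt0.
apply/funext => v; apply/propext; split.
  move=> bv; have [|p s1 e1] := bv (size s).-1.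
    by rewrite /patch_elt prednK// leqnn eqxx orbT.
  by rewrite /elt prednK// in e1; exists p.
move=> [p sp e] j /andP[jN /orP[/eqP jE|/eqP jE]].
  by rewrite jE ltnn in jN.
exists p => // y; rewrite /elt jE; have -> : j = (size s).-1 by rewrite -jE.
exact: e.
Qed.

Lemma omega_sub i : (i <= size s)%N -> l <= vtx l r s i.-1 /\ vtx l r s i.+1 <= r.
Proof.
move=> iN; split.
  by apply: (vtx_le ls (i := 0)); rewrite (leq_trans (leq_pred _) iN).
move: iN; rewrite leq_eqVlt => /orP[/eqP ->|iN]; first by rewrite vtx_sizeS.
by rewrite -[leRHS]vtx_size; apply: (vtx_le ls); rewrite iN leqnn.
Qed.

End MeshPatch.

Theorem lemma5p2 (R : realType) (kappa : R) (k : nat) (b : R) (hb : b != 0) :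
  exists C : R, 0 < C /\
  forall (l r : R) (s : seq R) (f u : R -> R),
    l < r ->
    itv_partition l r s ->
    shape_regular l r s kappa ->
    L2 [set` `]l, r[] f ->
    L2 [set` `]l, r[] u ->
    (forall i, (i <= size s)%N -> interior_vertex s i || inflow_vertex s b i ->
       ip (omega l r s i) f (hat l r s i)
       + ip (omega l r s i) u
           (fun x => b * wderiv (omega l r s i) (hat l r s i) x) = 0) ->
    forall i, (i <= size s)%N ->
    exists sh : R -> R,
      [/\ local_solution l r s b k f u i sh,
          (forall t, local_solution l r s b k f u i t ->
             {ae (@lebesgue_measure R),
                forall x, omega l r s i x -> t x = sh x})
        & nrm (omega l r s i) sh
          <= C * (h_omega l r s i * nrm (omega l r s i) f
                  + nrm (omega l r s i) u)].
Proof.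
exists (4 / `|b| + 4); split.
  by rewrite ltr_wpDl// divr_ge0.
move=> l r s f u lr ls _ fL uL compat i iN.
have [li ri] := omega_sub ls iN.
have f2 := L2S li ri fL; have u2 := L2S li ri uL.
have N0 := mesh_size_gt0 lr ls.
have [i0|i0] := posnP i.
  subst i; rewrite /local_solution /X_h broken_poly_first//.
  apply: (patch1_wellposed (up := false)) => //; last exact: hat_right.
  by apply: vtx_lt.
move: iN; rewrite leq_eqVlt => /orP[/eqP iE|iN].
  subst i; rewrite /local_solution /X_h broken_poly_last//.
  have NE : vtx l r s (size s).+1 = vtx l r s (size s) by rewrite vtx_sizeS (vtx_size ls).
  rewrite NE in f2 u2; rewrite /omega /h_omega NE.
  apply: (patch1_wellposed (up := true)) => //; last exact: hat_left.
  by apply: (vtx_lt ls); rewrite prednK// leqnn.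
rewrite /local_solution /X_h broken_poly_interior ?i0//.
apply: patch2_wellposed => //.
- by apply: (vtx_lt ls); rewrite prednK// leqnn ltnW.
- by apply: (vtx_lt ls); rewrite ltnSn.
- split; [exact: hat_left|exact: hat_right].
- by apply: compat; [exact: ltnW|rewrite /interior_vertex i0 iN].
Qed.
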